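(* A finite-dimensional complex Lie algebra $\mathcal{L}$ is Frattini-free if and only if it is isomorphic to the direct sum of (finitely many) Lie algebras of the following types: (i) one-dimensional algebras; (ii) simple Lie algebras; (iii) Lie algebras $L\oplus^{\mathrm{id}}X$, where $L$ is a decomposable Lie algebra of operators on a finite-dimensional linear space $X$.
   Context: A finite-dimensional Lie algebra is Frattini-free if the intersection of all its maximal proper Lie subalgebras is $\{0\}$ (for the zero algebra this holds trivially, and it is the empty direct sum). A Lie algebra $L$ of operators on a finite-dimensional complex linear space $X$ is decomposable if $X=X_{1}\dotplus\cdots\dotplus X_{n}$ (direct sum) where all $X_{k}$ are invariant for $L$ and the restriction of $L$ to each $X_{k}$ is irreducible (i.e. the $X_k$ are minimal non-zero invariant subspaces). $L\oplus^{\mathrm{id}}X$ is the semidirect product: the vector space of pairs $(a;x)$, $a\in L$, $x\in X$, with bracket $[(a;x),(b;y)]=([a,b];\,ay-bx)$. *)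

(* Defs.v *)
From HB Require Import structures.
From mathcomp Require Import all_boot all_order all_algebra.
From mathcomp Require Import reals complex.

Set Implicit Arguments.
Unset Strict Implicit.
Unset Printing Implicit Defensive.

Import GRing.Theory.
Local Open Scope ring_scope.

(* Lie algebras are finite-dimensional by construction: the carrier is a
   vectType. *)
HB.mixin Record Vector_isLie (K : fieldType) L of Vector K L := {
  bracket : L -> L -> L;
  bracket_linearl : forall y, linear (bracket^~ y);
  bracket_linearr : forall x, linear (bracket x);
  bracketxx : forall x, bracket x x = 0;
  bracket_jacobi : forall x y z,
    bracket x (bracket y z) + bracket y (bracket z x)
      + bracket z (bracket x y) = 0
}.

#[short(type="lieAlgType")]
HB.structure Definition LieAlgebra (K : fieldType) :=
  { L of Vector K L & Vector_isLie K L }.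

Notation "[ 'lie' x , y ]" := (bracket x y)
  (at level 0, x, y at level 99, format "[ 'lie'  x ,  y ]") : ring_scope.

Section LieNotions.
Variables (K : fieldType) (L M : lieAlgType K).

Definition lie_isomorphic : Prop :=
  exists f : 'Hom(L, M),
    bijective f /\ forall x y, f [lie x, y] = [lie f x, f y].

Definition subalgebra (U : {vspace L}) : Prop :=
  forall x y, x \in U -> y \in U -> [lie x, y] \in U.

Definition lie_ideal (U : {vspace L}) : Prop :=
  forall x y, y \in U -> [lie x, y] \in U.

Definition maximal_subalgebra (U : {vspace L}) : Prop :=
  [/\ subalgebra U, U <> fullv &
      forall V, subalgebra V -> (U <= V)%VS -> V = U \/ V = fullv].

(* For L = 0 there is no maximal proper subalgebra, and the empty
   intersection is L itself. *)
Definition frattini_free : Prop :=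
  forall x : L, (forall U, maximal_subalgebra U -> x \in U) -> x = 0.

(* Simple algebras are non-abelian; in particular a one-dimensional algebra
   is not simple. *)
Definition lie_simple : Prop :=
  (exists x y : L, [lie x, y] <> 0) /\
  forall U, lie_ideal U -> U = 0%VS \/ U = fullv.

End LieNotions.

Record lieSubalg (K : fieldType) (L : lieAlgType K) := LieSubalg {
  lsub_space :> {vspace L};
  lsub_closed : subalgebra lsub_space
}.

Definition lsub_type (K : fieldType) (L : lieAlgType K) (A : lieSubalg L) :=
  subvs_of A.

Section SubalgebraLie.
Variables (K : fieldType) (L : lieAlgType K) (A : lieSubalg L).
Local Notation T := (lsub_type A).

HB.instance Definition _ := Vector.copy T (subvs_of A).

Definition lsub_val : T -> L := vsval.

Lemma lsub_val_inj : injective lsub_val. Proof. exact: val_inj. Qed.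

Fact lsub_val_linear : linear lsub_val. Proof. exact: linearP. Qed.

HB.instance Definition _ :=
  GRing.isLinear.Build K T L *:%R lsub_val lsub_val_linear.

Lemma lsub_valD : {morph lsub_val : a b / a + b}. Proof. exact: linearD. Qed.

Definition lsub_bracket (a b : T) : T :=
  Subvs (lsub_closed (subvsP a) (subvsP b)).

Lemma lsub_bracketE a b :
  lsub_val (lsub_bracket a b) = [lie lsub_val a, lsub_val b].
Proof. by []. Qed.

Fact lsub_bracket_linearl b : linear (lsub_bracket^~ b).
Proof.
move=> k a c; apply: lsub_val_inj.
by rewrite linearP !lsub_bracketE linearP bracket_linearl.
Qed.

Fact lsub_bracket_linearr a : linear (lsub_bracket a).
Proof.
move=> k b c; apply: lsub_val_inj.
by rewrite linearP !lsub_bracketE linearP bracket_linearr.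
Qed.

Fact lsub_bracketxx a : lsub_bracket a a = 0.
Proof. by apply: lsub_val_inj; rewrite lsub_bracketE bracketxx linear0. Qed.

Fact lsub_jacobi a b c :
  lsub_bracket a (lsub_bracket b c) + lsub_bracket b (lsub_bracket c a)
    + lsub_bracket c (lsub_bracket a b) = 0.
Proof.
by apply: lsub_val_inj; rewrite !lsub_valD !lsub_bracketE bracket_jacobi linear0.
Qed.

HB.instance Definition _ := Vector_isLie.Build K T
  lsub_bracket_linearl lsub_bracket_linearr lsub_bracketxx lsub_jacobi.

Lemma lsub_lieE (a b : T) :
  lsub_val [lie a, b] = [lie lsub_val a, lsub_val b].
Proof. by []. Qed.
End SubalgebraLie.

Arguments lsub_val : simpl never.

(* An alias of 'End(X), so that the commutator bracket is only put on
   endomorphisms. *)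
Definition gl (K : fieldType) (X : vectType K) := 'End(X).

Section Gl.
Variables (K : fieldType) (X : vectType K).

HB.instance Definition _ := Vector.copy (gl X) 'End(X).

Definition gl_bracket (a b : gl X) : gl X :=
  ((a \o b)%VF - (b \o a)%VF : 'End(X)).

Lemma gl_bracketE a b x : gl_bracket a b x = a (b x) - b (a x).
Proof. by rewrite add_lfunE opp_lfunE !comp_lfunE. Qed.

Lemma gl_addE (a b : gl X) x : (a + b) x = a x + b x.
Proof. exact: add_lfunE. Qed.

Lemma gl_scaleE k (a : gl X) x : (k *: a) x = k *: a x.
Proof. exact: scale_lfunE. Qed.

Fact gl_bracket_linearl b : linear (gl_bracket^~ b).
Proof.
move=> k a c; apply/lfunP => x; rewrite [RHS]gl_addE gl_scaleE !gl_bracketE.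
by rewrite !gl_addE !gl_scaleE linearP scalerBr addrACA opprD.
Qed.

Fact gl_bracket_linearr a : linear (gl_bracket a).
Proof.
move=> k b c; apply/lfunP => x; rewrite [RHS]gl_addE gl_scaleE !gl_bracketE.
by rewrite !gl_addE !gl_scaleE linearP scalerBr addrACA opprD.
Qed.

Fact gl_bracketxx a : gl_bracket a a = 0.
Proof. exact: subrr. Qed.

Fact gl_jacobi a b c :
  gl_bracket a (gl_bracket b c) + gl_bracket b (gl_bracket c a)
    + gl_bracket c (gl_bracket a b) = 0.
Proof.
apply/lfunP => x.
rewrite (gl_addE (_ + _)) (gl_addE (gl_bracket a _)) !gl_bracketE.
rewrite !linearB /= [RHS]zero_lfunE !opprK !addrA.
rewrite [LHS](ACl (1*11*2*8*3*5*4*10*6*12*7*9)).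
by rewrite /= !(subrr, addNr, add0r).
Qed.

HB.instance Definition _ := Vector_isLie.Build K (gl X)
  gl_bracket_linearl gl_bracket_linearr gl_bracketxx gl_jacobi.

Lemma gl_lieE (a b : gl X) x : [lie a, b] x = a (b x) - b (a x).
Proof. exact: gl_bracketE. Qed.
End Gl.

Section Decomposable.
Variables (K : fieldType) (X : vectType K) (L : lieSubalg (gl X)).

Definition op_invariant (U : {vspace X}) : Prop :=
  forall a : gl X, a \in (L : {vspace gl X}) -> (a @: U <= U)%VS.

Definition minimal_invariant (U : {vspace X}) : Prop :=
  [/\ U <> 0%VS, op_invariant U &
      forall V, op_invariant V -> (V <= U)%VS -> V = 0%VS \/ V = U].

Definition decomposable : Prop :=
  exists (n : nat) (U : 'I_n -> {vspace X}),
    [/\ (\sum_i U i)%VS = fullv, directv (\sum_i U i)%VS &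
        forall i, minimal_invariant (U i)].
End Decomposable.

Definition semidirect (K : fieldType) (X : vectType K) (L : lieSubalg (gl X)) :=
  (lsub_type L * X)%type.

Section Semidirect.
Variables (K : fieldType) (X : vectType K) (L : lieSubalg (gl X)).
Local Notation T := (semidirect L).

HB.instance Definition _ := Vector.copy T (lsub_type L * X)%type.

Definition sd_bracket (u v : T) : T :=
  ([lie u.1, v.1], lsub_val u.1 v.2 - lsub_val v.1 u.2).

Fact sd_bracket_linearl v : linear (sd_bracket^~ v).
Proof.
move=> k u w; congr pair; first exact: bracket_linearl.
rewrite /= !linearP !gl_addE !gl_scaleE /=.
by rewrite scalerBr scalerN addrACA.
Qed.

Fact sd_bracket_linearr u : linear (sd_bracket u).
Proof.
move=> k v w; congr pair; first exact: bracket_linearr.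
rewrite /= !linearP !gl_addE !gl_scaleE /=.
by rewrite scalerBr addrACA opprD.
Qed.

Fact sd_bracketxx u : sd_bracket u u = 0.
Proof. by congr pair; [exact: bracketxx | exact: subrr]. Qed.

Fact sd_jacobi u v w :
  sd_bracket u (sd_bracket v w) + sd_bracket v (sd_bracket w u)
    + sd_bracket w (sd_bracket u v) = 0.
Proof.
congr pair; first exact: bracket_jacobi.
rewrite /= !lsub_lieE !gl_lieE !linearB /= !opprK !addrA.
rewrite [LHS](ACl (1*11*2*8*3*5*4*10*6*12*7*9)).
by rewrite /= !(subrr, addNr, add0r).
Qed.

HB.instance Definition _ := Vector_isLie.Build K T
  sd_bracket_linearl sd_bracket_linearr sd_bracketxx sd_jacobi.
End Semidirect.

Definition dsum (K : fieldType) (n : nat) (F : 'I_n -> lieAlgType K) :=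
  {dffun forall i, F i}.

Section DirectSum.
Variables (K : fieldType) (n : nat) (F : 'I_n -> lieAlgType K).
Import VectorInternalTheory.
Local Notation T := (dsum F).

HB.instance Definition _ := Choice.copy T {dffun forall i, F i}.

Definition dsum_mk (f : forall i, F i) : T := finfun f.

Lemma dsum_mkE f i : dsum_mk f i = f i. Proof. exact: ffunE. Qed.

Lemma dsumP (f g : T) : (forall i, f i = g i) -> f = g.
Proof. by move=> fg; apply/ffunP. Qed.

Definition dsum_zero : T := dsum_mk (fun i => 0).
Definition dsum_opp (f : T) : T := dsum_mk (fun i => - f i).
Definition dsum_add (f g : T) : T := dsum_mk (fun i => f i + g i).
Definition dsum_scale (k : K) (f : T) : T := dsum_mk (fun i => k *: f i).
Definition dsum_bracket (f g : T) : T := dsum_mk (fun i => [lie f i, g i]).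

Fact dsum_addA : associative dsum_add.
Proof. by move=> f g h; apply: dsumP => i; rewrite !dsum_mkE addrA. Qed.
Fact dsum_addC : commutative dsum_add.
Proof. by move=> f g; apply: dsumP => i; rewrite !dsum_mkE addrC. Qed.
Fact dsum_add0 : left_id dsum_zero dsum_add.
Proof. by move=> f; apply: dsumP => i; rewrite !dsum_mkE add0r. Qed.
Fact dsum_addN : left_inverse dsum_zero dsum_opp dsum_add.
Proof. by move=> f; apply: dsumP => i; rewrite !dsum_mkE addNr. Qed.

HB.instance Definition _ :=
  GRing.isZmodule.Build T dsum_addA dsum_addC dsum_add0 dsum_addN.

Fact dsum_scaleA a b f : dsum_scale a (dsum_scale b f) = dsum_scale (a * b) f.
Proof. by apply: dsumP => i; rewrite !dsum_mkE scalerA. Qed.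
Fact dsum_scale1 : left_id 1 dsum_scale.
Proof. by move=> f; apply: dsumP => i; rewrite !dsum_mkE scale1r. Qed.
Fact dsum_scaleDr : right_distributive dsum_scale +%R.
Proof. by move=> a f g; apply: dsumP => i; rewrite !dsum_mkE scalerDr. Qed.
Fact dsum_scaleDl f : {morph dsum_scale^~ f : a b / a + b}.
Proof. by move=> a b; apply: dsumP => i; rewrite !dsum_mkE scalerDl. Qed.

HB.instance Definition _ := GRing.Zmodule_isLmodule.Build K T
  dsum_scaleA dsum_scale1 dsum_scaleDr dsum_scaleDl.

Lemma dsum_zeroE i : (0 : T) i = 0. Proof. exact: dsum_mkE. Qed.
Lemma dsum_oppE (f : T) i : (- f) i = - f i. Proof. exact: dsum_mkE. Qed.
Lemma dsum_addE (f g : T) i : (f + g) i = f i + g i. Proof. exact: dsum_mkE. Qed.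
Lemma dsum_scaleE k (f : T) i : (k *: f) i = k *: f i. Proof. exact: dsum_mkE. Qed.
Lemma dsum_bracketE (f g : T) i : dsum_bracket f g i = [lie f i, g i].
Proof. exact: dsum_mkE. Qed.

Fact dsum_vect_iso : Vector.axiom (\sum_i dim (F i)) T.
Proof.
exists (fun f : T => \mxrow_i v2r (f i)) => [k f g|].
  apply/mxrowP => i; rewrite mxrowK submxrowD.
  rewrite dsum_addE dsum_scaleE linearP mxrowK; congr (_ + _).
  set A := \mxrow_j _; have -> : submxrow (k *: A) i = k *: submxrow A i.
    by apply/matrixP => a b; rewrite !mxE.
  by rewrite mxrowK.
exists (fun r => dsum_mk (fun i => r2v (submxrow r i))) => [f|r].
  by apply: dsumP => i; rewrite dsum_mkE mxrowK v2rK.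
by apply/mxrowP => i; rewrite mxrowK dsum_mkE r2vK.
Qed.

HB.instance Definition _ := Lmodule_hasFinDim.Build K T dsum_vect_iso.

Fact dsum_bracket_linearl g : linear (dsum_bracket^~ g).
Proof.
move=> k f h; apply: dsumP => i.
by rewrite dsum_addE dsum_scaleE !dsum_bracketE dsum_addE dsum_scaleE
  bracket_linearl.
Qed.

Fact dsum_bracket_linearr f : linear (dsum_bracket f).
Proof.
move=> k g h; apply: dsumP => i.
by rewrite dsum_addE dsum_scaleE !dsum_bracketE dsum_addE dsum_scaleE
  bracket_linearr.
Qed.

Fact dsum_bracketxx f : dsum_bracket f f = 0.
Proof.
by apply: dsumP => i; rewrite dsum_bracketE bracketxx dsum_zeroE.
Qed.

Fact dsum_jacobi f g h :
  dsum_bracket f (dsum_bracket g h) + dsum_bracket g (dsum_bracket h f)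
    + dsum_bracket h (dsum_bracket f g) = 0.
Proof.
by apply: dsumP => i; rewrite !dsum_addE !dsum_bracketE bracket_jacobi dsum_zeroE.
Qed.

HB.instance Definition _ := Vector_isLie.Build K T
  dsum_bracket_linearl dsum_bracket_linearr dsum_bracketxx dsum_jacobi.
End DirectSum.

Inductive frattini_free_summand (K : fieldType) : lieAlgType K -> Prop :=
| OneDimensional (M : lieAlgType K) of \dim {:M} = 1%N :
    frattini_free_summand M
| SimpleLie (M : lieAlgType K) of lie_simple M : frattini_free_summand M
| SemidirectId (X : vectType K) (L : lieSubalg (gl X)) of decomposable L :
    frattini_free_summand (semidirect L).

(* Main.v *)
(* Frattini-free implies decomposed.  Take an abelian ideal N of maximal
   dimension.  In a Frattini-free algebra every abelian ideal has a
   complementary subalgebra (a subalgebra B of minimal dimension with A + B = L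
   meets A in an ideal contained in every maximal subalgebra); hence L = N + B,
   and ideals inside N have ideal complements in N.  The ideal I = B n C(N)
   contains no nonzero abelian ideal of L.  By Cartan's and Engel's arguments
   the trace form tr(ad x ad y) is nondegenerate on every non-abelian minimal
   ideal, so L = I + I^perp with I a direct sum of simple ideals, and
   I^perp = N + (B n I^perp), where B n I^perp acts faithfully and completely
   reducibly on N.
   Conversely, maximal subalgebras pull back along surjections, which handles
   direct sums.  In a semidirect product the preimages of the maximal invariant
   subspaces of X under the maps (a; y) |-> y + a x are maximal subalgebras with
   trivial intersection.  In a simple algebra the Frattini subalgebra is stable
   under exp(ad y) for y ad-nilpotent, hence normalised by all ad-nilpotent
   elements, and these force it to be an ideal. *)

Require Import Defs.
From HB Require Import structures.
From mathcomp Require Import all_boot all_order all_algebra.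
From mathcomp Require Import reals complex boolp spectral.

Set Implicit Arguments.
Unset Strict Implicit.
Unset Printing Implicit Defensive.

Import Order.TTheory GRing.Theory Num.Theory.
Local Open Scope ring_scope.

(** * Linear operators *)

Lemma chinese_poly (F : fieldType) (f : F -> F) e (s : seq F) :
  exists p : {poly F},
    forall l, l \in s -> ('X - l%:P) ^+ e %| p - (f l)%:P.
Proof.
elim: s => [|a s [p IHp]]; first by exists 0.
have [a_s|a_s] := boolP (a \in s).
  by exists p => l; rewrite inE => /predU1P[->|]; apply: IHp.
pose q := (\prod_(l <- s) ('X - l%:P)) ^+ e.
have /Bezout_eq1_coprimepP[[u v] /= uvE] : coprimep (('X - a%:P) ^+ e) q.
  by rewrite coprimep_expl // coprimep_expr // coprimep_sym coprimep_XsubC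
    root_prod_XsubC.
(* Modulo [('X - a%:P) ^+ e] the factor [v * q] is 1, and modulo the powers for the older roots it
   is 0, so only the residue at [a] is corrected. *)
exists (p + v * q * ((f a)%:P - p)) => l; rewrite inE => /predU1P[->|l_s].
  have -> : p + v * q * ((f a)%:P - p) - (f a)%:P
      = u * ('X - a%:P) ^+ e * (p - (f a)%:P).
    have -> : u * ('X - a%:P) ^+ e = 1 - v * q by rewrite -uvE addrK.
    by rewrite mulrBl mul1r -mulrN opprB addrAC.
  by rewrite dvdp_mulr // dvdp_mull.
rewrite addrAC dvdp_add ?IHp // dvdp_mulr // dvdp_mull // dvdp_exp2r //.
by rewrite (big_rem l) //= dvdp_mulr.
Qed.

Lemma mul_trig_mx (F : fieldType) n (A B : 'M[F]_n) :
  is_trig_mx A -> is_trig_mx B ->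
  is_trig_mx (A *m B) /\ forall i, (A *m B) i i = A i i * B i i.
Proof.
move=> /is_trig_mxP At /is_trig_mxP Bt; split=> [|i].
  apply/is_trig_mxP => i j ij; rewrite mxE big1 // => k _.
  have [ik|ki] := ltnP i k; first by rewrite At ?mul0r.
  by rewrite Bt ?mulr0 // (leq_ltn_trans ki).
rewrite mxE (bigD1 i) //= big1 ?addr0 // => k; rewrite neq_ltn => /orP[ki|ik].
  by rewrite Bt ?mulr0.
by rewrite At ?mul0r.
Qed.

Lemma horner_mx_trig (F : fieldType) n (A : 'M[F]_n.+1) p :
  is_trig_mx A ->
  is_trig_mx (horner_mx A p) /\ forall i, horner_mx A p i i = p.[A i i].
Proof.
move=> At; elim/poly_ind: p => [|p c [pt pE]].
  by rewrite rmorph0 mx0_is_trig; split=> // i; rewrite mxE horner0.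
rewrite rmorphD rmorphM /= horner_mx_X horner_mx_C.
have [/is_trig_mxP mt mE] := mul_trig_mx pt At.
have /is_trig_mxP ct := scalar_mx_is_trig n.+1 c.
split=> [|i].
  by apply/is_trig_mxP => i j ij; rewrite mxE mt // ct ?addr0.
by rewrite mxE mE pE !mxE eqxx mulr1n !hornerE.
Qed.

(** By Schur triangularization: [s] is the diagonal of a triangular conjugate, so Cayley-Hamilton
    gives the first claim and [horner_mx_trig] the second. *)
Lemma mx_spectrum (C : numClosedFieldType) n (A : 'M[C]_n.+1) :
  exists s : seq C,
    horner_mx A (\prod_(l <- s) ('X - l%:P)) = 0 /\
    forall p, \tr (horner_mx A p) = \sum_(l <- s) p.[l].
Proof.
have [//|P Pu Pt] := @Schur _ _ A.
have Punit := unitarymx_unit Pu.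
set T := conjmx P A in Pt.
have hE p : horner_mx T p = P *m horner_mx A p *m invmx P.
  by rewrite /T conjumx // horner_mx_uconj.
exists [seq T i i | i <- index_enum 'I_n.+1]; rewrite big_map; split.
  rewrite -char_poly_trig //; apply: (can_inj (mulKmx Punit)).
  apply: (can_inj (mulmxK (_ : invmx P \in unitmx)));
    first by rewrite unitmx_inv.
  by rewrite -hE Cayley_Hamilton mulmx0 mul0mx.
move=> p; rewrite big_map; have [_ TE] := horner_mx_trig p Pt.
transitivity (\tr (horner_mx T p)); last by apply: eq_bigr => i _; rewrite TE.
by rewrite hE mxtrace_mulC mulKmx.
Qed.

(** [D] is a polynomial in [A] chosen by [chinese_poly]: it acts as [f] of the semisimple part of
    [A] and stabilizes every [A]-stable subspace. *)
Lemma mx_semisimple_fun (C : numClosedFieldType) n (A : 'M[C]_n) :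
  exists s : seq C,
    foldr (fun l B => (A - l%:M) *m B) 1%:M s = 0 /\
    forall f : C -> C, exists D : 'M[C]_n,
      [/\ forall l (v : 'rV_n), l \in s ->
            iter n (mulmxr (A - l%:M)) v = 0 -> v *m D = f l *: v,
          forall m (U : 'M_(m, n)),
            (U *m A <= U)%MS -> (U *m D <= U)%MS &
          \tr (A *m D) = \sum_(l <- s) l * f l].
Proof.
case: n => [|n] in A *.
  exists [::]; rewrite /= flatmx0; split=> // f; exists 0; split=> //.
    by move=> m U _; rewrite mulmx0 sub0mx.
  by rewrite big_nil mulmx0 mxtrace0.
have [s [As0 trA]] := mx_spectrum A; exists s; split=> [|f].
  rewrite -[RHS]As0; elim: s {As0 trA} => [|l s IHs] /=.
    rewrite big_nil; apply: esym; apply: (rmorph1 (horner_mx A)).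
  by rewrite IHs big_cons rmorphM rmorphB /= horner_mx_X horner_mx_C.
have [p pP] := chinese_poly f n.+1 s.
exists (horner_mx A p); split=> [l v l_s | m U AU |].
- move=> vA0; have /dvdpP[q pE] := pP _ l_s.
  have {pE}-> : p = ('X - l%:P) ^+ n.+1 * q + (f l)%:P.
    by rewrite mulrC -pE subrK.
  rewrite rmorphD rmorphM rmorphXn rmorphB /= horner_mx_X !horner_mx_C.
  rewrite mulmxDr mul_mx_scalar mulmxA.
  suff -> : v *m (A - l%:M) ^+ n.+1 = 0 by rewrite mul0mx add0r.
  have iterE k : iter k (mulmxr (A - l%:M)) v = v *m (A - l%:M) ^+ k.
    elim: k => [|k IHk]; first by rewrite expr0 [RHS]mulmx1.
    by rewrite iterS IHk exprSr mulmxA.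
  by rewrite -iterE.
- elim/poly_ind: p {pP} => [|q c IHq]; first by rewrite rmorph0 mulmx0 sub0mx.
  rewrite rmorphD rmorphM /= horner_mx_X horner_mx_C mulmxDr mul_mx_scalar.
  rewrite addmx_sub ?scalemx_sub // mulmxA (submx_trans _ AU) //.
  exact: submxMr.
(* The trace is the sum of the [l * p.[l]], and [p.[l] = f l] because ['X - l%:P] divides
   [p - (f l)%:P]. *)
have -> : A *m horner_mx A p = horner_mx A ('X * p).
  by rewrite rmorphM /= horner_mx_X.
rewrite trA; apply: eq_big_seq => l l_s; rewrite hornerM hornerX; congr (_ * _).
have /dvdpP[q pE] := pP _ l_s.
have {pE}-> : p = ('X - l%:P) ^+ n.+1 * q + (f l)%:P.
  by rewrite mulrC -pE subrK.
by rewrite !hornerE subrr expr0n /= mul0r add0r.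
Qed.

(** * Operators as matrices, and the trace *)

Section Operators.
Import VectorInternalTheory.
Variables (K : fieldType) (V : vectType K).
Implicit Types (A B : 'End(V)) (U W : {vspace V}).

Definition lfun_tr A : K := \tr (f2mx A).

Lemma v2r_lfun A v : v2r (A v) = v2r v *m f2mx A.
Proof. by rewrite unlock /= r2vK. Qed.

Lemma f2mx_comp A B : f2mx (A \o B)%VF = f2mx B *m f2mx A.
Proof.
apply/row_matrixP => i; rewrite !rowE.
have dE : delta_mx 0 i = v2r (r2v (delta_mx 0 i) : V) by rewrite r2vK.
by rewrite dE mulmxA -!v2r_lfun comp_lfunE.
Qed.

Lemma f2mxP k A B : f2mx (k *: A + B) = k *: f2mx A + f2mx B.
Proof.
apply/row_matrixP => i; rewrite !rowE.
have dE : delta_mx 0 i = v2r (r2v (delta_mx 0 i) : V) by rewrite r2vK.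
rewrite dE mulmxDr -scalemxAr -!v2r_lfun add_lfunE scale_lfunE.
exact: linearP.
Qed.

Lemma lfun_trP k A B : lfun_tr (k *: A + B) = k * lfun_tr A + lfun_tr B.
Proof. by rewrite /lfun_tr f2mxP linearP. Qed.

Lemma lfun_tr0 : lfun_tr 0 = 0.
Proof. by have := lfun_trP (-1) 0 0; rewrite scaler0 addr0 mulN1r addNr. Qed.

Lemma lfun_trD A B : lfun_tr (A + B) = lfun_tr A + lfun_tr B.
Proof. by rewrite -[A]scale1r lfun_trP scale1r mul1r. Qed.

Lemma lfun_trN A : lfun_tr (- A) = - lfun_tr A.
Proof. by rewrite -[- A]addr0 -scaleN1r lfun_trP lfun_tr0 addr0 mulN1r. Qed.

Lemma lfun_trC A B : lfun_tr (A \o B)%VF = lfun_tr (B \o A)%VF.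
Proof. by rewrite /lfun_tr !f2mx_comp mxtrace_mulC. Qed.

Definition shift A l : 'End(V) := A - l *: \1%VF.

Lemma shiftE A l v : shift A l v = A v - l *: v.
Proof. by rewrite add_lfunE opp_lfunE scale_lfunE id_lfunE. Qed.

Lemma v2r_shift A l v :
  v2r (shift A l v) = v2r v *m (f2mx A - l%:M).
Proof. by rewrite shiftE linearB linearZ /= v2r_lfun mulmxBr mul_mx_scalar. Qed.

End Operators.

Section ClosedOperators.
Import VectorInternalTheory.
Variables (C : numClosedFieldType) (V : vectType C).
Implicit Types (A B : 'End(V)) (U W : {vspace V}).

Lemma semisimple_fun A :
  exists s : seq C,
    (forall v, foldl (fun w l => shift A l w) v s = 0) /\
    forall f : C -> C, exists D : 'End(V),
      [/\ forall l v, l \in s ->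
            iter (dim V) (shift A l) v = 0 -> D v = f l *: v,
          forall U, (A @: U <= U)%VS -> (D @: U <= U)%VS &
          lfun_tr (A \o D)%VF = \sum_(l <- s) l * f l].
Proof.
have [s [As0 sP]] := mx_semisimple_fun (f2mx A).
exists s; split=> [v|f].
  apply: v2r_inj; rewrite linear0 -(mulmx0 _ (v2r v)) -As0.
  elim: {As0 sP} s v => [|l s IHs] v /=; first by rewrite mulmx1.
  by rewrite IHs v2r_shift mulmxA.
have [D [Deig Dstab Dtr]] := sP f; exists (Hom D); split=> [l v l_s vA|U UA|].
- apply: v2r_inj; rewrite v2r_lfun linearZ /=; apply: (Deig _ _ l_s).
  have iterE k : iter k (mulmxr (f2mx A - l%:M)) (v2r v) = v2r (iter k (shift A
    l) v).
    by elim: k => //= k ->; rewrite v2r_shift.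
  by rewrite iterE vA linear0.
- move: UA; rewrite unlock /subsetv !genmxE; exact: Dstab.
by rewrite /lfun_tr f2mx_comp mxtrace_mulC.
Qed.
End ClosedOperators.

(** The exponent is left free, so that closure under brackets need not respect a bound; [geig_dim]
    bounds it by the dimension afterwards. *)
Definition geig (K : fieldType) (V : vectType K) (A : 'End(V)) l v : Prop :=
  exists n, iter n (shift A l) v = 0.

(** The sum of all generalized eigenspaces, made inductive so that additive properties can be
    checked on generalized eigenvectors. *)
Inductive gsum (K : fieldType) (V : vectType K) (A : 'End(V)) : V -> Prop :=
| Gsum0 : gsum A 0
| GsumGen l v of geig A l v : gsum A v
| GsumD u v of gsum A u & gsum A v : gsum A (u + v).

(** * Generalized eigenspaces span *)

Section GeneralizedEigenspaces.
Variables (K : fieldType) (V : vectType K).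
Implicit Types (A B : 'End(V)) (U W : {vspace V}).

Lemma iter_lfun0 B n : iter n B 0 = 0.
Proof. by elim: n => //= n ->; rewrite linear0. Qed.

Lemma iter_lfunP B n k u v : iter n B (k *: u + v) = k *: iter n B u + iter n B
  v.
Proof. by elim: n => //= n ->; rewrite linearP. Qed.

Lemma iter_lfunD B n u v : iter n B (u + v) = iter n B u + iter n B v.
Proof. by have := iter_lfunP B n 1 u v; rewrite !scale1r. Qed.

Lemma iter_lfunZ B n k u : iter n B (k *: u) = k *: iter n B u.
Proof. by have := iter_lfunP B n k u 0; rewrite iter_lfun0 !addr0. Qed.

Lemma ex_iter_lfun B n : exists C : 'End(V), forall v, C v = iter n B v.
Proof.
elim: n => [|n [C CE]]; first by exists \1%VF => u; rewrite id_lfunE.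
by exists (B \o C)%VF => u; rewrite comp_lfunE CE.
Qed.

(* The images B^k W of a B-stable subspace W shrink strictly
   until they vanish. *)
Lemma iter_lfun_dim B n v : iter n B v = 0 -> iter (dim V) B v = 0.
Proof.
move=> vB0; have [Bn BnE] := ex_iter_lfun B n.
suff nilp d U : (\dim U <= d)%N -> (B @: U <= U)%VS ->
    (forall u, u \in U -> iter n B u = 0) ->
    forall u, u \in U -> iter d B u = 0.
  apply: (nilp _ (lker Bn)); last by rewrite memv_ker BnE vB0.
  - by rewrite -dimvf dimvS ?subvf.
  - apply/subvP => _ /memv_imgP[u + ->]; rewrite !memv_ker !BnE.
    by rewrite -iterSr => /eqP uB; rewrite iterS uB linear0.
  by move=> u; rewrite memv_ker BnE => /eqP.
elim: d U => [|d IHd] U dU BU nU u uU.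
  by move: dU uU; rewrite leqn0 dimv_eq0 => /eqP->; rewrite memv0 => /eqP.
have [dBU|dBU] := leqP (\dim (B @: U)) d.
  rewrite iterSr; apply: (IHd (B @: U)%VS) => //; first exact: limgS.
    by move=> x xU; apply: nU; apply: (subvP BU).
  exact: memv_img.
have BUE : (B @: U)%VS = U by apply/eqP; rewrite eqEdim BU (leq_trans dU).
(* When [B] maps [U] onto itself, every vector of [U] is an [n]-th iterate, hence 0. *)
have onto k : exists2 w, w \in U & u = iter k B w.
  elim: k => [|k [w + uE]]; first by exists u.
  rewrite -{1}BUE uE => /memv_imgP[x xU ->]; by exists x; rewrite // -iterSr.
have [w wU ->] := onto n; by rewrite nU ?iter_lfun0.
Qed.

Lemma geig_dim A l v : geig A l v -> iter (dim V) (shift A l) v = 0.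
Proof. by case=> n; apply: iter_lfun_dim. Qed.

Lemma geig0 A l : geig A l 0.
Proof. by exists 0. Qed.

Lemma geigP A l k u v : geig A l u -> geig A l v -> geig A l (k *: u + v).
Proof.
move=> /geig_dim uA /geig_dim vA; exists (dim V).
by rewrite iter_lfunP uA vA scaler0 addr0.
Qed.

(** On this eigenspace [A - l] is the nonzero scalar [m - l] plus a nilpotent operator; the preimage
    is built by induction on the exponent. *)
Lemma geig_onto A l m w :
  l != m -> geig A m w -> exists2 u, geig A m u & shift A l u = w.
Proof.
move=> lm [n]; elim: n w => [|n IHn] w; first by exists 0;
  [exact: geig0|rewrite linear0].
rewrite iterSr => wA.
have ml0 : m - l != 0 by rewrite subr_eq0 eq_sym.
have [|u uA ulE] := IHn ((m - l)^-1 *: shift A m w).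
  by rewrite iter_lfunZ wA scaler0.
exists ((m - l)^-1 *: w - u).
  rewrite -scaleN1r addrC; apply: geigP => //; rewrite -[_ *: w]addr0.
  by apply: geigP; [exists n.+1; rewrite iterSr | exact: geig0].
transitivity ((m - l)^-1 *: (shift A l w - shift A m w)).
  by rewrite linearB linearZ /= ulE scalerBr.
rewrite !shiftE opprB [_ - l *: w + _]addrC addrA subrK -scalerBl scalerA mulVf
  //.
by rewrite scale1r.
Qed.

(* [A - l] is invertible on the generalized eigenspaces for the other
   eigenvalues, so it is onto [gsum A] up to a correction in the one for [l]. *)
Lemma gsum_onto A l w :
  gsum A w -> exists u r, [/\ gsum A u, geig A l r & shift A l u = w - r].
Proof.
elim=> [|m v vA|u v _ [u1 [r1 [u1A r1A E1]]] _ [u2 [r2 [u2A r2A E2]]]].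
- by exists 0, 0; split; [exact: Gsum0|exact: geig0|rewrite linear0 subrr].
- have [lm|lm] := eqVneq l m.
    exists 0, v; rewrite lm; split=> //; first exact: Gsum0.
    by rewrite linear0 subrr.
  have [u uA uE] := geig_onto lm vA.
  exists u, 0; rewrite subr0; split=> //; [exact: GsumGen uA|exact: geig0].
exists (u1 + u2), (r1 + r2); split; first exact: GsumD.
  by rewrite -[r1]scale1r; apply: geigP.
by rewrite linearD /= E1 E2 opprD addrACA.
Qed.

(* [s] lists (with repetitions) the roots of a polynomial annihilating [A]. *)
Definition annihilates A (s : seq K) :=
  forall v, foldl (fun w l => shift A l w) v s = 0.

(** Induction on [s]: [gsum_onto] solves [(A - l) u = (A - l) v - r] with [r] a generalized
    eigenvector for [l], so [v - u] is one as well. *)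
Lemma annihilates_gsum A s v : annihilates A s -> gsum A v.
Proof.
move=> /(_ v); elim: s v => [|l s IHs] v /= => [->|]; first exact: Gsum0.
move=> /IHs/gsum_onto-/(_ l)[u [r [uA [n rA] uE]]].
rewrite -[v](subrK u); apply: GsumD => //; apply: (@GsumGen _ _ _ l).
by exists n.+1; rewrite iterSr linearB /= uE opprB addrC subrK.
Qed.

Lemma geig_eigenvector A l v :
  geig A l v -> v != 0 -> exists2 w, w != 0 & shift A l w = 0.
Proof.
case=> n; elim: n v => [|n IHn] v; first by move=> /= -> /eqP.
rewrite iterSr => vA v0; have [w0|w0] := eqVneq (shift A l v) 0;
  first by exists v.
exact: IHn vA w0.
Qed.

(** An eigenvector for [l] is multiplied by [l - m] for each [m] in [s], and the product vanishes
    only if [l] is one of them. *)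
Lemma annihilates_geig A s l v :
  annihilates A s -> geig A l v -> v != 0 -> l \in s.
Proof.
move=> As vA /(geig_eigenvector vA)[w w0 wA]; move: (As w); apply: contra_eqT.
elim: s {v vA As} w w0 wA => //= m s IHs w w0 wA.
rewrite inE negb_or => /andP[lm ls].
have -> : shift A m w = (l - m) *: w.
  by move/eqP: wA; rewrite !shiftE subr_eq0 => /eqP->; rewrite scalerBl.
apply: IHs => //; first by rewrite scaler_eq0 negb_or subr_eq0 lm.
by rewrite linearZ /= wA scaler0.
Qed.

End GeneralizedEigenspaces.

(** * Lie algebras and maximal subalgebras *)

Section ExtremalSubspaces.
Variables (K : fieldType) (V : vectType K).
Implicit Types (U W : {vspace V}) (P : {vspace V} -> Prop).

Lemma ex_min_dim P : (exists U, P U) ->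
  exists2 U, P U & forall W, P W -> (\dim U <= \dim W)%N.
Proof.
move=> [U0 PU0]; have exn : exists n, `[< exists2 U, P U & \dim U = n >].
  by exists (\dim U0); apply/asboolP; exists U0.
case: (ex_minnP exn) => n /asboolP[U PU <-] nmin; exists U => // W PW.
by apply: nmin; apply/asboolP; exists W.
Qed.

Lemma ex_max_dim P : (exists U, P U) ->
  exists2 U, P U & forall W, P W -> (\dim W <= \dim U)%N.
Proof.
move=> [U0 PU0]; have exn : exists n, `[< exists2 U, P U & \dim U = n >].
  by exists (\dim U0); apply/asboolP; exists U0.
have bd n : `[< exists2 U, P U & \dim U = n >] -> (n <= \dim {:V})%N.
  by move=> /asboolP[U _ <-]; rewrite dimvS ?subvf.
case: (ex_maxnP exn bd) => n /asboolP[U PU <-] nmax; exists U => // W PW.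
by apply: nmax; apply/asboolP; exists W.
Qed.

(** A subspace of maximal dimension inside [p] absorbs every vector satisfying [p]. This turns
    linear conditions into subspaces. *)
Lemma vspace_of_pred (p : V -> Prop) :
  p 0 -> (forall k u v, p u -> p v -> p (k *: u + v)) ->
  exists U : {vspace V}, forall v, v \in U <-> p v.
Proof.
move=> p0 pP; have [|U Up Umax] := @ex_max_dim (fun U => forall v, v \in U -> p
  v).
  by exists 0%VS => v; rewrite memv0 => /eqP->.
exists U => v; split=> [|pv]; first exact: Up.
have Uv : (U <= U + <[v]>)%VS := addvSl _ _.
suff /eqP-> : U == (U + <[v]>)%VS by rewrite memvE addvSr.
rewrite eqEdim Uv Umax // => _ /memv_addP[u uU [_ /vlineP[k ->] ->]].
by rewrite addrC; apply: pP => //; apply: Up.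
Qed.

End ExtremalSubspaces.

HB.instance Definition _ (K : fieldType) (L : lieAlgType K) (x : L) :=
  GRing.isLinear.Build K L L *:%R (bracket x) (bracket_linearr x).

Section LieBasics.
Variables (K : fieldType) (L : lieAlgType K).
Implicit Types (x y z : L) (U W A B I J : {vspace L}) (k : K).

Lemma lieDr x y z : [lie x, y + z] = [lie x, y] + [lie x, z].
Proof. exact: linearD. Qed.

Lemma lieZr x k y : [lie x, k *: y] = k *: [lie x, y].
Proof. exact: linearZ. Qed.

Lemma lieNr x y : [lie x, - y] = - [lie x, y].
Proof. exact: linearN. Qed.

Lemma lie0r x : [lie x, 0] = 0.
Proof. exact: linear0. Qed.

Lemma lieDl x y z : [lie x + y, z] = [lie x, z] + [lie y, z].
Proof. by have := bracket_linearl z 1 x y; rewrite /= !scale1r. Qed.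

Lemma lieC x y : [lie x, y] = - [lie y, x].
Proof.
apply/eqP; rewrite -addr_eq0; have := bracketxx (x + y).
by rewrite lieDl !lieDr !bracketxx add0r addr0 => ->.
Qed.

Lemma lieZl k x y : [lie k *: x, y] = k *: [lie x, y].
Proof. by rewrite lieC lieZr -scalerN -lieC. Qed.

Lemma lieNl x y : [lie - x, y] = - [lie x, y].
Proof. by rewrite lieC lieNr -lieC. Qed.

Lemma lie0l x : [lie 0, x] = 0.
Proof. by rewrite lieC lie0r oppr0. Qed.

Lemma lieA x y z : [lie x, [lie y, z]] = [lie [lie x, y], z] + [lie y, [lie x,
  z]].
Proof.
have /eqP := bracket_jacobi x y z.
rewrite -addrA addr_eq0 => /eqP->; rewrite opprD addrC.
by rewrite (lieC z) opprK (lieC z x) lieNr opprK.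
Qed.

Definition ad x : 'End(L) := linfun (bracket x).

Lemma adE x y : ad x y = [lie x, y].
Proof. by rewrite lfunE. Qed.

Lemma adP k x y : ad (k *: x + y) = k *: ad x + ad y.
Proof.
by apply/lfunP => z; rewrite add_lfunE scale_lfunE !adE lieDl lieZl.
Qed.

Lemma ad_lie x y : ad [lie x, y] = (ad x \o ad y)%VF - (ad y \o ad x)%VF.
Proof.
apply/lfunP => z; rewrite add_lfunE opp_lfunE !comp_lfunE !adE.
by rewrite (lieA x) addrK.
Qed.

Lemma lie_idealr U x y : lie_ideal U -> x \in U -> [lie x, y] \in U.
Proof. by move=> Ui xU; rewrite lieC memvN Ui. Qed.

Lemma ideal_subalgebra U : lie_ideal U -> subalgebra U.
Proof. by move=> Ui x y _; apply: Ui. Qed.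

Lemma ideal0 : lie_ideal (0 : {vspace L})%VS.
Proof. by move=> x y; rewrite !memv0 => /eqP->; rewrite lie0r. Qed.

Lemma ideal_cap U W : lie_ideal U -> lie_ideal W -> lie_ideal (U :&: W)%VS.
Proof. by move=> Ui Wi x y /memv_capP[yU yW]; rewrite memv_cap Ui ?Wi. Qed.

Lemma ideal_add U W : lie_ideal U -> lie_ideal W -> lie_ideal (U + W)%VS.
Proof.
move=> Ui Wi x _ /memv_addP[u uU [w wW ->]].
by rewrite lieDr memv_add ?Ui ?Wi.
Qed.

Lemma subalgebra0 : subalgebra (0 : {vspace L})%VS.
Proof. exact: ideal_subalgebra ideal0. Qed.

Lemma subalgebraf : subalgebra {:L}%VS.
Proof. by move=> x y _ _; apply: memvf. Qed.

Lemma subalgebra_cap U W :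
  subalgebra U -> subalgebra W -> subalgebra (U :&: W)%VS.
Proof.
by move=> Us Ws x y /memv_capP[? ?] /memv_capP[? ?]; rewrite memv_cap Us ?Ws.
Qed.

Lemma subalgebra_add U W :
  subalgebra U -> lie_ideal W -> subalgebra (U + W)%VS.
Proof.
move=> Us Wi _ _ /memv_addP[u uU [w wW ->]] /memv_addP[u' uU' [w' wW' ->]].
rewrite lieDl !lieDr -addrA memv_add ?Us //; apply: memvD; first exact: Wi.
by apply: memvD; [exact: lie_idealr | exact: Wi].
Qed.

Lemma ex_maximal_subalgebra_in W U :
  subalgebra U -> (U <= W)%VS -> U <> W ->
  exists M, [/\ subalgebra M, (U <= M <= W)%VS, M <> W &
    forall B, subalgebra B -> (M <= B <= W)%VS -> B = M \/ B = W].
Proof.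
move=> Us UW neUW; pose P M := [/\ subalgebra M, (U <= M <= W)%VS & M <> W].
have [|M [Ms UMW neMW] Mmax] := @ex_max_dim _ _ P.
  by exists U; split; rewrite ?subvv.
exists M; split=> // B Bs /andP[MB BW].
have [->|/eqP neBW] := eqVneq B W; [by right|left].
apply/esym/eqP; rewrite eqEdim MB Mmax //; split=> //.
by rewrite BW andbT; case/andP: UMW => UM _; apply: subv_trans MB.
Qed.

Lemma ex_maximal_subalgebra U : subalgebra U -> U <> fullv ->
  exists2 M, maximal_subalgebra M & (U <= M)%VS.
Proof.
move=> Us Uf; have [M [Ms /andP[UM _] Mf Mmax]] :=
  ex_maximal_subalgebra_in Us (subvf _) Uf.
by exists M => //; split=> // V Vs MV; apply: Mmax; rewrite // MV subvf.
Qed.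

Lemma ex_frattini : exists F : {vspace L},
  forall x, x \in F <-> forall U, maximal_subalgebra U -> x \in U.
Proof.
apply: vspace_of_pred => [U _|k u v uF vF U Umax]; first exact: mem0v.
by rewrite memvD ?memvZ ?uF ?vF.
Qed.

Definition derived U : {vspace L} :=
  <<[seq [lie x, y] | x <- vbasis U, y <- vbasis U]>>%VS.

Lemma mem_derived U x y : x \in U -> y \in U -> [lie x, y] \in derived U.
Proof.
have sub v : v \in U -> v \in <<vbasis U>>%VS by rewrite (span_basis (vbasisP
  U)).
move=> /sub xU /sub yU; rewrite (coord_span xU) (coord_span yU).
rewrite linear_sum /=; apply: memv_suml => j _.
rewrite lieZr; apply: memvZ; rewrite lieC memvN.
rewrite linear_sum /=; apply: memv_suml => i _; rewrite lieZr; apply: memvZ;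
  rewrite lieC memvN.
by apply/memv_span/allpairs_f; rewrite mem_nth // size_tuple.
Qed.

Lemma derived_le U W :
  (forall x y, x \in U -> y \in U -> [lie x, y] \in W) -> (derived U <= W)%VS.
Proof.
move=> UW; apply/span_subvP => _ /allpairsP[[x y] /= [xU yU ->]].
by apply: UW; apply: vbasis_mem.
Qed.

Lemma derived_ideal U : lie_ideal U -> lie_ideal (derived U).
Proof.
move=> Ui z w wD; rewrite -adE memv_preim; apply: (subvP _ _ wD) => {w wD}.
apply: derived_le => x y xU yU; rewrite -memv_preim adE lieA.
by rewrite memvD // mem_derived // Ui.
Qed.

Lemma idealS_derived U : lie_ideal U -> (derived U <= U)%VS.
Proof. by move=> Ui; apply: derived_le => x y _; apply: Ui. Qed.

End LieBasics.

(** * Semidirect products and direct sums *)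

(** A subalgebra containing the preimage contains the kernel of [f], so it is the preimage of its
    image, to which maximality of [U] applies. *)
Lemma maximal_preim (K : fieldType) (L M : lieAlgType K) (f : 'Hom(L, M))
    (U : {vspace M}) :
  (forall x y, f [lie x, y] = [lie f x, f y]) -> limg f = fullv ->
  maximal_subalgebra U -> maximal_subalgebra (f @^-1: U)%VS.
Proof.
move=> fM f_onto [Us Uf Umax]; have onto y : exists x, y = f x.
  have : y \in limg f by rewrite f_onto memvf.
  by case/memv_imgP=> x _ ->; exists x.
split=> [x y||V Vs UV].
- by rewrite -!memv_preim fM; apply: Us.
- move=> fU; apply: Uf; apply/vspaceP => y; have [x ->] := onto y.
  by rewrite memv_preim fU !memvf.
have kerV x : f x = 0 -> x \in V.
  by move=> fx; apply: (subvP UV); rewrite -memv_preim fx mem0v.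
have imV x : (x \in V) = (f x \in (f @: V)%VS).
  apply/idP/memv_imgP => [xV|[v vV fxv]]; first by exists x.
  by rewrite -(subrK v x) memvD // kerV // linearB /= fxv subrr.
have [||imU|imf] := Umax (f @: V)%VS.
- move=> _ _ /memv_imgP[x xV ->] /memv_imgP[y yV ->].
  by rewrite -fM memv_img // Vs.
- apply/subvP => y; have [x ->] := onto y.
  by rewrite memv_preim => /(subvP UV); apply: memv_img.
- by left; apply/vspaceP => x; rewrite imV imU memv_preim.
- by right; apply/vspaceP => x; rewrite imV imf !memvf.
Qed.

Lemma frattini_free_dim1 (K : fieldType) (L : lieAlgType K) :
  \dim {:L} = 1%N -> frattini_free L.
Proof.
move=> L1 x /(_ 0%VS) x0; apply/eqP; rewrite -memv0; apply: x0; split.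
- exact: subalgebra0.
- by move=> L0; move: L1; rewrite -L0 dimv0.
move=> V _ _; case: (posnP (\dim V)) => [/eqP|Vpos].
  by rewrite dimv_eq0 => /eqP; left.
by right; apply/eqP; rewrite eqEdim subvf L1.
Qed.

Section SemidirectFrattini.
Variables (K : fieldType) (X : vectType K) (L : lieSubalg (gl X)).
Local Notation T := (semidirect L).
Implicit Types (U W : {vspace X}).

Lemma lsub_valP (a : lsub_type L) : lsub_val a \in (L : {vspace gl X}).
Proof. exact: subvsP. Qed.

Lemma sd_lieE (u v : T) :
  [lie u, v] = ([lie u.1, v.1], lsub_val u.1 v.2 - lsub_val v.1 u.2) :> T.
Proof. by []. Qed.

Lemma lsub_actE k (a b : lsub_type L) x :
  lsub_val (k *: a + b) x = k *: lsub_val a x + lsub_val b x.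
Proof. by rewrite linearP gl_addE gl_scaleE. Qed.

(* The translate by [x] of the semidirect product's second projection; its
   kernel is the image of [L] under the inner automorphism [exp (ad (0; x))]. *)
Definition sd_proj (x : X) (u : T) : X := u.2 + lsub_val u.1 x.

Fact sd_proj_linear x : linear (sd_proj x).
Proof.
by move=> k u v; rewrite /sd_proj /= lsub_actE scalerDr addrACA.
Qed.
HB.instance Definition _ x :=
  GRing.isLinear.Build K T X *:%R (sd_proj x) (sd_proj_linear x).

Lemma sd_proj_lie x u v :
  sd_proj x [lie u, v] = lsub_val u.1 (sd_proj x v) - lsub_val v.1 (sd_proj x
    u).
Proof.
rewrite /sd_proj sd_lieE /= lsub_lieE gl_lieE !linearD /=.
by rewrite addrACA.
Qed.

Definition maximal_invariant W :=
  [/\ op_invariant L W, W <> fullv &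
    forall U, op_invariant L U -> (W <= U)%VS -> U = W \/ U = fullv].

(** Since [f [lie u, v] = u.1 (f v) - v.1 (f u)], invariant subspaces pull back to subalgebras. A
    larger subalgebra contains the kernel of [f], and brackets with the kernel realize all operators
    of [L] on its image, which is therefore invariant. *)
Lemma maximal_sd_preim x W : maximal_invariant W ->
  maximal_subalgebra (linfun (sd_proj x) @^-1: W)%VS.
Proof.
move=> [Wi Wf Wmax]; set f := linfun _.
have fE u : f u = u.2 + lsub_val u.1 x by rewrite lfunE.
have f_lie u v : f [lie u, v] = lsub_val u.1 (f v) - lsub_val v.1 (f u).
  by rewrite !lfunE; apply: sd_proj_lie.
have fX y : f (0, y) = y by rewrite fE /= linear0 zero_lfunE addr0.
have act (a : lsub_type L) U y : op_invariant L U -> y \in U -> lsub_val a y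
  \in U.
  by move=> Ui yU; apply: (subvP (Ui _ (lsub_valP a))); apply: memv_img.
split=> [u v||V Vs WV].
- by rewrite -!memv_preim f_lie => uW vW; rewrite memvB ?act.
- move=> fW; apply: Wf; apply/vspaceP => y.
  by rewrite -[y]fX memv_preim fW !memvf.
have kerV u : f u = 0 -> u \in V.
  by move=> fu; apply: (subvP WV); rewrite -memv_preim fu mem0v.
have imV u : (u \in V) = (f u \in (f @: V)%VS).
  apply/idP/memv_imgP => [uV|[v vV fuv]]; first by exists u.
  by rewrite -(subrK v u) memvD // kerV // linearB /= fuv subrr.
have [||imW|imf] := Wmax (f @: V)%VS.
- move=> a aL; apply/subvP => _ /memv_imgP[_ /memv_imgP[v vV ->] ->].
  pose a' : lsub_type L := Subvs aL.
  (* The element of the kernel of [f] lying over [a]: bracketing with it acts as [a] on [f v]. *)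
  pose u : T := (a', - lsub_val a' x).
  have uK : f u = 0 by rewrite fE /= addNr.
  have -> : a (f v) = f [lie u, v] by rewrite f_lie uK linear0 subr0.
  by rewrite memv_img // Vs // kerV.
- apply/subvP => y yW; rewrite -[y]fX memv_img //; apply: (subvP WV).
  by rewrite -memv_preim fX.
- by left; apply/vspaceP => u; rewrite imV imW memv_preim.
- by right; apply/vspaceP => u; rewrite imV imf !memvf.
Qed.

(** The sum of all summands but one is a maximal invariant subspace because the remaining one is
    minimal; these sums have zero intersection. *)
Lemma decomposable_maximal_invariant : decomposable L ->
  forall x, (forall W, maximal_invariant W -> x \in W) -> x = 0.
Proof.
move=> [n [U [Usum Udir Umin]]] x xW.
have Uinv i : op_invariant L (U i) by case: (Umin i).
pose W k := (\sum_(i | i != k) U i)%VS.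
have WU k : (U k + W k)%VS = fullv by rewrite -Usum (bigD1 k).
have UW0 k : (U k :&: W k)%VS = 0%VS by apply: (directv_sumP Udir).
have Winv k : op_invariant L (W k).
  move=> a aL; rewrite limg_sum; apply/subv_sumP => i ik.
  apply: subv_trans (Uinv i _ aL) _; exact: (sumv_sup i).
have Wmax k : maximal_invariant (W k).
  have [Uk0 _ Ukmin] := Umin k.
  split=> // [Wf|V Vi WV].
    by apply: Uk0; rewrite -(UW0 k) Wf capvf.
  have VE : V = (W k + U k :&: V)%VS.
    by rewrite vspace_modl // addvC WU capfv.
  have [||UV0|UVU] := Ukmin (U k :&: V)%VS.
  - move=> a aL; apply/subvP => _ /memv_imgP[y /memv_capP[yU yV] ->].
    rewrite memv_cap (subvP (Uinv k _ aL)) ?memv_img //=.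
    by apply: (subvP (Vi _ aL)); rewrite memv_img.
  - exact: capvSl.
  - by left; rewrite VE UV0 addv0.
  - by right; rewrite VE UVU addvC WU.
have : x \in (\sum_i U i)%VS by rewrite Usum memvf.
case/memv_sumP=> y yU xE.
suff y0 i : y i = 0 by rewrite xE big1.
apply/eqP; rewrite -memv0 -(UW0 i) memv_cap yU //=.
have -> : y i = x - \sum_(j | j != i) y j by rewrite xE (bigD1 i) //= addrK.
by rewrite memvB ?xW // memv_sumr // => j _; apply: yU.
Qed.

(** The translates by all [x] force [y + a x = 0] for every [x]; [x = 0] gives [y = 0], and then the
    operator [a] vanishes. *)
Lemma frattini_free_semidirect : decomposable L -> frattini_free T.
Proof.
move=> /decomposable_maximal_invariant Lmax [a y] Fu.
have ayx x : y + lsub_val a x = 0.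
  apply: Lmax => W Wmax; have := Fu _ (maximal_sd_preim x Wmax).
  by rewrite -memv_preim lfunE.
have y0 : y = 0 by have := ayx 0; rewrite linear0 addr0.
congr pair => //; apply: lsub_val_inj; rewrite linear0.
by apply/lfunP => x; rewrite zero_lfunE -(ayx x) y0 add0r.
Qed.

End SemidirectFrattini.

Section DsumFrattini.
Variables (K : fieldType) (n : nat) (F : 'I_n -> lieAlgType K).

Definition dsum_proj i (f : dsum F) : F i := f i.

Fact dsum_proj_linear i : linear (@dsum_proj i).
Proof. by move=> k f g; rewrite /dsum_proj dsum_addE dsum_scaleE. Qed.
HB.instance Definition _ i :=
  GRing.isLinear.Build K (dsum F) (F i) *:%R (@dsum_proj i) (dsum_proj_linear
    i).

Lemma dsum_proj_onto i (x : F i) : exists f : dsum F, f i = x.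
Proof.
exists (dsum_mk (fun j =>
  if i =P j is ReflectT e then ecast j (F j) e x else 0)).
by rewrite dsum_mkE; case: eqP => // e; rewrite (eq_axiomK e).
Qed.

Lemma frattini_free_dsum (L : lieAlgType K) :
  lie_isomorphic L (dsum F) -> (forall i, frattini_free (F i)) ->
  frattini_free L.
Proof.
move=> [g [[h gK hK] gM]] FF x Fx.
suff gx0 : g x = 0 by rewrite -(gK x) gx0 -(linear0 g) gK.
apply: dsumP => i; rewrite dsum_zeroE; apply: FF => U Umax.
pose f : 'Hom(L, F i) := (linfun (@dsum_proj i) \o g)%VF.
have fE y : f y = g y i by rewrite comp_lfunE lfunE.
have fM y z : f [lie y, z] = [lie f y, f z].
  by rewrite !fE gM; apply: dsum_bracketE.
have f_onto : limg f = fullv.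
  apply/vspaceP => y; rewrite memvf; have [u <-] := dsum_proj_onto y.
  by apply/memv_imgP; exists (h u); rewrite ?memvf // fE hK.
by rewrite -fE memv_preim; apply: Fx; apply: maximal_preim.
Qed.

End DsumFrattini.

(** * Simple algebras *)

(* If [p t] denotes the sum, the combination [p (2 t) - 2 ^ n p t] cancels the
   leading term. *)
Lemma polynomial_coef_mem (K : numFieldType) (V : vectType K) (U : {vspace V})
    n (v : nat -> V) :
  (forall t : K, \sum_(k < n) t ^+ k *: v k \in U) ->
  forall k, (k < n)%N -> v k \in U.
Proof.
elim: n v => // n IHn v vU.
have vltn k : (k < n)%N -> v k \in U.
  move=> kn; have c0 : (2 : K) ^+ k - 2 ^+ n != 0.
    by rewrite subr_eq0 -!natrX eqr_nat eqn_exp2l // ltn_eqF.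
  rewrite -[v k](scalerK c0) memvZ //; apply: (IHn (fun k => _ *: v k)) kn => t.
  have := memvB (vU (2 * t)) (memvZ (2 ^+ n) (vU t)).
  rewrite !big_ord_recr /= scalerDr opprD addrACA scalerA exprMn subrr addr0.
  rewrite scaler_sumr -sumrB; congr (_ \in U); apply: eq_bigr => i _.
  by rewrite exprMn !scalerA -scalerBl -mulrBl mulrC.
move=> k; rewrite ltnS leq_eqVlt => /orP[/eqP->|]; last exact: vltn.
have := vU 1; rewrite big_ord_recr /= expr1n scale1r => vnU.
rewrite -[v n](addKr (\sum_(i < n) 1 ^+ i *: v i)) addrC memvB //.
by rewrite memv_suml // => i _; rewrite memvZ // vltn.
Qed.

(** Indices [i, j < n] satisfy [i + j < n.*2], so the triangle holds every nonzero term of the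
    square. Used to multiply truncated exponentials. *)
Lemma sum_triangle_square (V : nmodType) n (f : nat -> nat -> V) :
  (forall i j, (n <= i)%N || (n <= j)%N -> f i j = 0) ->
  \sum_(k < n.*2) \sum_(i < k.+1) f i (k - i)%N
    = \sum_(i < n.*2) \sum_(j < n.*2) f i j.
Proof.
move=> f0; rewrite -!(big_mkord xpredT (fun k => \sum_(i < k.+1) f i (k -
  i)%N)).
rewrite -(big_mkord xpredT (fun i => \sum_(j < n.*2) f i j)).
transitivity (\sum_(0 <= k < n.*2) \sum_(0 <= i < n.*2 | (i <= k)%N) f i (k -
  i)%N).
  apply: eq_big_nat => k /andP[_ kn];
    rewrite -(big_mkord xpredT (fun i => f i (k - i)%N)).
  by rewrite (big_nat_widen _ _ n.*2).
rewrite (exchange_big_dep_nat xpredT) //=; apply: eq_big_nat => i /andP[_ i2n].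
rewrite -(big_mkord xpredT (f i)).
have [ni|ni] := leqP n i; first by rewrite !big1 // => *; rewrite f0 ?ni.
rewrite -(big_nat_widenl i 0 n.*2 xpredT) // -[X in \sum_(X <= _ < _) _]add0n
  big_addn.
rewrite [RHS](@big_cat_nat _ _ _ (n.*2 - i)) ?leq_subr //=.
have -> : \sum_(n.*2 - i <= j < n.*2) f i j = 0.
  rewrite big_nat big1 // => j /andP[ij _]; rewrite f0 //.
  by rewrite (leq_trans _ ij) ?orbT // -addnn -addnBA ?leq_addr // ltnW.
by rewrite addr0; apply: eq_bigr => j _; rewrite addnK.
Qed.

(** * Exponentials of nilpotent inner derivations *)

Section NilpotentAutomorphism.
Variables (K : numFieldType) (L : lieAlgType K).
Implicit Types (x y z a b : L) (U : {vspace L}).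

(** The terms of the exponential of [ad y]; the factorial rids the Leibniz rule of binomial
    coefficients. *)
Definition divpow y k a : L := k`!%:R^-1 *: iter k (ad y) a.

Lemma divpowS y k a : k.+1%:R *: divpow y k.+1 a = [lie y, divpow y k a].
Proof.
rewrite /divpow iterS adE lieZr scalerA factS natrM invfM.
by rewrite mulVKf ?pnatr_eq0.
Qed.

Lemma lie_divpow_r y k a b :
  [lie a, [lie y, divpow y k b]] = k.+1%:R *: [lie a, divpow y k.+1 b].
Proof. by rewrite -divpowS lieZr. Qed.

(** Induction after multiplying by [k.+1], which splits as [i + (k.+1 - i)], one part for each
    factor that the derivation can hit. *)
Lemma divpow_lie y k a b :
  divpow y k [lie a, b] = \sum_(i < k.+1) [lie divpow y i a, divpow y (k - i)
    b].
Proof.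
elim: k => [|k IHk].
  by rewrite big_ord_recl big_ord0 addr0 /divpow /= fact0 invr1 !scale1r.
have k0 : k.+1%:R != 0 :> K by rewrite pnatr_eq0.
apply: (scalerI k0); rewrite divpowS IHk linear_sum scaler_sumr /=.
transitivity (\sum_(i < k.+1) (i.+1%:R *: [lie divpow y i.+1 a, divpow y (k -
  i) b]
   + (k.+1 - i)%:R *: [lie divpow y i a, divpow y (k.+1 - i) b])).
  apply: eq_bigr => i _; rewrite lieA -divpowS lieZl.
  have ik : (i <= k)%N by rewrite -ltnS.
  by rewrite (subSn ik) lie_divpow_r.
rewrite big_split /=.
transitivity (\sum_(i < k.+2) i%:R *: [lie divpow y i a, divpow y (k.+1 - i) b]
  + \sum_(i < k.+2) (k.+1 - i)%:R *: [lie divpow y i a, divpow y (k.+1 - i) b]).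
  congr (_ + _); first by rewrite [RHS]big_ord_recl scale0r add0r.
  by rewrite [RHS]big_ord_recr /= subnn scale0r addr0.
rewrite -big_split; apply: eq_bigr => i _ /=.
by rewrite -scalerDl -natrD subnKC // -ltnS.
Qed.

(** The truncated exponential of [ad (t *: y)] is an automorphism and preserves [F], as maximal
    subalgebras pull back. Hence the coefficient of [t] in its value at [x], which is [[lie y, x]],
    lies in [F]. *)
Lemma frattini_nilpotent_stable (F : {vspace L}) y n :
  (forall x, x \in F <-> forall U, maximal_subalgebra U -> x \in U) ->
  (forall v, iter n (ad y) v = 0) -> forall x, x \in F -> [lie y, x] \in F.
Proof.
(* With [n.+1] the bound [N.*2] exceeds 1 even for [n = 0], so the coefficient of index 1 is always
   in range. *)
move=> FP yn x xF; pose N := n.+1.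
have dp0 z k a : (forall v, iter n (ad z) v = 0) -> (N <= k)%N -> divpow z k a
  = 0.
  move=> zn Nk; rewrite /divpow -(subnK (ltnW Nk)) iterD.
  by rewrite zn iter_lfun0 scaler0.
have exp_mem z : (forall v, iter n (ad z) v = 0) -> 
    \sum_(k < N.*2) divpow z k x \in F.
  move=> zn.
  have [E EE] : exists E : 'End(L), forall a, E a = \sum_(k < N.*2) divpow z k
    a.
    elim: (N.*2) => [|m [E EE]].
      by exists 0 => a; rewrite big_ord0 zero_lfunE.
    have [B BE] := ex_iter_lfun (ad z) m.
    exists (E + m`!%:R^-1 *: B) => a.
    by rewrite big_ord_recr add_lfunE scale_lfunE EE BE.
  have EM a b : E [lie a, b] = [lie E a, E b].
    rewrite !EE; under eq_bigr do rewrite divpow_lie.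
    rewrite (sum_triangle_square (f := fun i j => [lie divpow z i a, divpow z j
      b])).
      rewrite linear_sum /= exchange_big; apply: eq_bigr => j _.
      by rewrite lieC linear_sum -sumrN; apply: eq_bigr => i _; rewrite -lieC.
    by move=> i j /orP[] Ni; rewrite (dp0 _ _ _ zn Ni) ?lie0l ?lie0r.
  have E_inj : lker E == 0%VS.
    rewrite -subv0; apply/subvP => a; rewrite memv_ker EE memv0 => /eqP ea0.
    (* Applying [(ad z)^k] to the vanishing series leaves only its leading term, so the exponent
       killing [a] descends to 0. *)
    have down k : iter k.+1 (ad z) a = 0 -> iter k (ad z) a = 0.
      move=> ka0; have [B BE] := ex_iter_lfun (ad z) k.
      rewrite -[RHS](linear0 B) -ea0 linear_sum big_ord_recl /= big1 ?addr0.
        by rewrite BE /divpow fact0 invr1 scale1r.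
      move=> i _; rewrite BE /divpow iter_lfunZ -iterD addnC.
      by rewrite /bump leq0n add1n addSnnS iterD ka0 iter_lfun0 scaler0.
    have up k : iter k (ad z) a = 0 -> a = 0 by elim: k => [|k IHk] // /down.
    by apply/eqP/(up n).
  rewrite -EE; apply/FP => U Umax; rewrite memv_preim.
  by move/FP: xF; apply; apply: maximal_preim; rewrite ?lker0_limgf.
have <- : divpow y 1 x = [lie y, x].
  by rewrite -[LHS]scale1r (divpowS y 0) /divpow fact0 invr1 scale1r.
apply: (@polynomial_coef_mem K L F N.*2 (fun k => divpow y k x)) => // t.
have <- : \sum_(k < N.*2) divpow (t *: y) k x = \sum_(k < N.*2) t ^+ k *:
  divpow y k x.
  apply: eq_bigr => k _; rewrite /divpow scalerA mulrC -scalerA.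
  congr (_ *: _); elim: (k : nat) => [|m IHm] /=; first by rewrite scale1r.
  by rewrite IHm !adE lieZl lieZr scalerA exprS.
apply: exp_mem => v.
have -> : iter n (ad (t *: y)) v = t ^+ n *: iter n (ad y) v.
  elim: n {yn N dp0} => [|m IHm] /=; first by rewrite scale1r.
  by rewrite IHm !adE lieZl lieZr scalerA exprS.
by rewrite yn scaler0.
Qed.

End NilpotentAutomorphism.

Section GeigLie.
Variables (K : fieldType) (L : lieAlgType K).
Implicit Types (x y z u v : L) (U I : {vspace L}).

Lemma shift_ad_lie x l m u v :
  shift (ad x) (l + m) [lie u, v]
    = [lie shift (ad x) l u, v] + [lie u, shift (ad x) m v].
Proof.
rewrite !shiftE !adE lieA lieDl lieDr lieNl lieNr lieZl lieZr.
by rewrite scalerDl opprD addrACA.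
Qed.

(** [ad x] is a derivation, so each shift lowers the exponent of one of the two factors, and [i + j]
    shifts suffice. *)
Lemma geig_lie x l m u v : geig (ad x) l u -> geig (ad x) m v ->
  geig (ad x) (l + m) [lie u, v].
Proof.
move=> [i ui] [j vj]; exists (i + j)%N.
suff nil n : forall i j u v, (i + j <= n)%N -> iter i (shift (ad x) l) u = 0 ->
    iter j (shift (ad x) m) v = 0 ->
    iter n (shift (ad x) (l + m)) [lie u, v] = 0 by exact: nil ui vj.
elim: n {i j u v ui vj} => [|n IHn] i j u v ij ui vj.
  move: ij ui; rewrite leqn0 addn_eq0 => /andP[/eqP-> _] /= ->.
  by rewrite lie0l.
rewrite iterSr shift_ad_lie iter_lfunD.
case: i ij ui => [|i] ij ui; first by move: ui => /= ->;
  rewrite !(linear0, lie0l) iter_lfun0 addr0.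
case: j ij vj => [|j] ij vj; first by move: vj => /= ->;
  rewrite !(linear0, lie0r) iter_lfun0 addr0.
rewrite (IHn i j.+1) ?add0r // -?iterSr // (IHn i.+1 j) // -?iterSr //.
by rewrite addSnnS.
Qed.

End GeigLie.

(** Powers of [ad y] move the eigenvalue [m] to [m + l *+ k]. In characteristic 0 these are
    distinct, while all eigenvalues lie in the finite list [s]. *)
Lemma geig_nilpotent (K : numFieldType) (L : lieAlgType K) s (x y : L) l :
  annihilates (ad x) s ->
  l != 0 -> geig (ad x) l y -> forall v, iter (dim L) (ad y) v = 0.
Proof.
move=> xs l0 yl v.
elim: (annihilates_gsum v xs) => [|m w wm|u w _ uy _ wy]; last first.
- by rewrite iter_lfunD uy wy addr0.
- have geig_k k : geig (ad x) (m + l *+ k) (iter k (ad y) w).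
    elim: k => [|k IHk]; first by rewrite addr0.
    by rewrite iterS adE mulrS addrCA; apply: geig_lie.
  have [[k /eqP wk]|wk] := pselect (exists k, iter k (ad y) w == 0).
    exact: iter_lfun_dim wk.
  have ms k : m + l *+ k \in s.
    by apply: annihilates_geig xs (geig_k k) _; apply/eqP => wk0; apply: wk;
      exists k; apply/eqP.
  suff : (size [seq (m + l *+ k)%R | k <- iota 0 (size s).+1] <= size s)%N.
    by rewrite size_map size_iota ltnn.
  apply: uniq_leq_size => [|_ /mapP[k _ ->]] //.
  rewrite map_inj_uniq ?iota_uniq // => i j /addrI lij.
  apply/eqP; rewrite -(eqr_nat K); apply/eqP/(mulIf l0).
  by rewrite !mulr_natl.
exact: iter_lfun0.
Qed.

(* If [ad z] is not nilpotent, its generalized eigenspaces for nonzero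
   eigenvalues consist of ad-nilpotent elements and generate a nonzero ideal. *)
Lemma frattini_free_simple (C : numClosedFieldType) (L : lieAlgType C) :
  lie_simple L -> frattini_free L.
Proof.
move=> [[a [b ab0]] Lsimple]; have [F FP] := ex_frattini L.
suff Fi : lie_ideal F.
  move=> x /FP xF; case: (Lsimple _ Fi) => FE.
    by move: xF; rewrite FE memv0 => /eqP.
  have [|M [Ms Mf Mmax] _] := ex_maximal_subalgebra (@subalgebra0 _ L).
    move=> L0; apply: ab0; apply/eqP.
    by rewrite -memv0 L0 memvf.
  case: (Mf); apply/vspaceP => y; rewrite memvf; apply: ((FP y).1 _ M) => //.
  by rewrite FE memvf.
(* The normalizer of [F], a subalgebra containing every ad-nilpotent element. *)
have [N NP] : exists N : {vspace L},
    forall z, z \in N <-> forall x, x \in F -> [lie z, x] \in F.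
  apply: vspace_of_pred => [w _|k u v uF vF w wF].
    by rewrite lie0l mem0v.
  by rewrite lieDl lieZl memvD ?memvZ ?uF ?vF.
have Ns : subalgebra N.
  move=> u v /NP uF /NP vF; apply/NP => x xF.
  have -> : [lie [lie u, v], x] = [lie u, [lie v, x]] - [lie v, [lie u, x]].
    by rewrite (lieA u) addrK.
  by apply: memvB; [apply/uF/vF | apply/vF/uF].
have Nnil y : (forall v, iter (dim L) (ad y) v = 0) -> y \in N.
  by move=> ynil; apply/NP; apply: frattini_nilpotent_stable FP ynil.
move=> z x xF; apply: (NP z).1 (xF); apply: contrapT => zN.
have [s [zs _]] := semisimple_fun (ad z).
(* [P] is closed under intersection, so a subalgebra of minimal dimension satisfying it is the least
   one. *)
pose P (I : {vspace L}) := subalgebra I /\ forall l v, l != 0 -> geig (ad z) l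
  v -> v \in I.
have [|I [Is Ieig] Imin] := @ex_min_dim _ _ P.
  by exists fullv; split; [exact: subalgebraf | move=> *; apply: memvf].
have Ileast J : P J -> (I <= J)%VS.
  move=> [Js Jeig]; apply/capv_idPl/eqP; rewrite eqEdim capvSl Imin //.
  split=> [|l v l0 vl]; first exact: subalgebra_cap.
  by rewrite memv_cap (Ieig l) ?(Jeig l).
have IN : (I <= N)%VS.
  apply: Ileast; split=> // l v l0 vl; apply: Nnil;
    exact: geig_nilpotent zs l0 vl.
have Ii : lie_ideal I.
  move=> w u uI; elim: (annihilates_gsum w zs) => [|l v vl|v1 v2 _ ? _ ?].
  - by rewrite lie0l mem0v.
  - have [l0|l0] := eqVneq l 0; last by rewrite Is // (Ieig l).
    (* For [v] of eigenvalue 0, the elements of [I] that [ad v] maps into [I] satisfy [P] again, so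
       by leastness they exhaust [I]. *)
    suff /Ileast/subvP/(_ u uI) : P (I :&: (ad v @^-1: I))%VS.
      by rewrite memv_cap -memv_preim adE => /andP[].
    split=> [u1 u2|m u' m0 um].
      rewrite !memv_cap -!memv_preim !adE => /andP[u1I vu1] /andP[u2I vu2].
      by rewrite Is //= lieA; apply: memvD; apply: Is.
    rewrite memv_cap (Ieig m) //= -memv_preim adE (Ieig m) //.
    by rewrite -[m]add0r -l0; apply: geig_lie.
  by rewrite lieDl memvD.
(* If [I] is everything, so is [N]; if [I] is 0, only the eigenvalue 0 remains and [ad z] is
   nilpotent. Either way [z] lies in [N]. *)
have [I0|If] := Lsimple I Ii; last by apply: zN; apply: (subvP IN);
  rewrite If memvf.
apply/zN/Nnil => v; apply: (@iter_lfun_dim _ _ _ (dim L)).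
elim: (annihilates_gsum v zs) => [|l w wl|u w _ uz _ wz].
- exact: iter_lfun0.
- have [l0|l0] := eqVneq l 0.
    have adzE u : shift (ad z) 0 u = ad z u by rewrite shiftE scale0r subr0.
    have := geig_dim wl; rewrite l0 => <-.
    by apply: eq_iter => u; rewrite adzE.
  by have := Ieig _ _ l0 wl; rewrite I0 memv0 => /eqP->; rewrite iter_lfun0.
by rewrite iter_lfunD uz wz addr0.
Qed.

(** * Engel's theorem and Cartan's criterion *)

Section Engel.
Variables (K : fieldType) (L : lieAlgType K).
Implicit Types (x y z u v : L) (H M S U W : {vspace L}).

Lemma lie_addv_line M v : subalgebra M ->
  (forall m, m \in M -> [lie m, v] \in M) ->
  forall x y, x \in (M + <[v]>)%VS -> y \in (M + <[v]>)%VS -> [lie x, y] \in M.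
Proof.
move=> Ms Mv x y /memv_addP[m mM [_ /vlineP[k ->] ->]].
move=> /memv_addP[m' mM' [_ /vlineP[k' ->] ->]].
rewrite lieDl !lieDr !lieZl !lieZr bracketxx !scaler0 addr0.
rewrite (lieC v); apply: memvD; last by rewrite memvZ // memvN Mv.
by apply: memvD; [apply: Ms | apply/memvZ/Mv].
Qed.

(* Relative form of Engel's theorem: a common zero vector of [H] in [U / W]. *)
Lemma engel H U W : subalgebra H ->
  (forall x, x \in H -> forall v, iter (dim L) (ad x) v = 0) ->
  (forall h u, h \in H -> u \in U -> [lie h, u] \in U) ->
  (forall h w, h \in H -> w \in W -> [lie h, w] \in W) ->
  ~~ (U <= W)%VS ->
  exists v, [/\ v \in U, v \notin W & forall h, h \in H -> [lie h, v] \in W].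
Proof.
move: {2}(\dim H) (leqnn (\dim H)) => n.
elim: n H U W => [|n IHn] H U W dH Hs Hnil HU HW nUW.
  have [v vU vW] := subvPn nUW; exists v; split=> // h.
  move: dH; rewrite leqn0 dimv_eq0 => /eqP->; rewrite memv0 => /eqP->.
  by rewrite lie0l mem0v.
have [H0|/eqP H0] := eqVneq H 0%VS.
  by apply: IHn => //; rewrite H0 dimv0.
have [|H' [Hs' /andP[_ HH'] nHH' Hmax]] :=
  ex_maximal_subalgebra_in (@subalgebra0 _ L) (sub0v H); first by move/esym.
have inH h : h \in H' -> h \in H by apply: (subvP HH').
have dH' : (\dim H' <= n)%N.
  rewrite -ltnS (leq_trans _ dH) // ltn_neqAle dimvS // andbT.
  by apply/eqP => dd; apply: nHH'; apply/eqP; rewrite eqEdim HH' dd leqnn.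
have nHsub : ~~ (H <= H')%VS.
  by apply/negP => HsH; apply: nHH'; apply/eqP; rewrite eqEsubv HH'.
(* Induction for [H'] acting on [H / H'] yields [x] outside [H'] normalizing it; maximality of [H']
   then gives [H = H' + <x>]. *)
have [|||x [xH xH' Hx]] := IHn H' H H' dH' Hs' _ _ _ nHsub.
- by move=> x /inH; apply: Hnil.
- by move=> h u /inH hH uH; apply: Hs.
- exact: Hs'.
have Hxlie := lie_addv_line Hs' Hx.
have HE : H = (H' + <[x]>)%VS.
  have [|||] // := Hmax (H' + <[x]>)%VS.
  - by move=> y z yB zB; apply: (subvP (addvSl _ _)); apply: Hxlie.
  - by rewrite addvSl subv_add HH' -memvE.
  by move=> E; move: xH'; rewrite -E memvE addvSr.
have [Z ZP] : exists Z : {vspace L}, forall v,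
    v \in Z <-> v \in U /\ forall h, h \in H' -> [lie h, v] \in W.
  apply: vspace_of_pred => [|k u v [uU uW] [vU vW]].
    by split=> [|h _]; rewrite ?lie0r mem0v.
  split=> [|h hH]; first by rewrite memvD ?memvZ.
  by rewrite lieDr lieZr memvD ?memvZ ?uW ?vW.
have xZ v : v \in Z -> [lie x, v] \in Z.
  move=> /ZP[vU vW]; apply/ZP; split=> [|h hH]; first exact: HU.
  by rewrite lieA memvD //; [apply/vW/Hx | apply/HW/vW].
have [|||v [vU vW Hv]] := IHn H' U W dH' Hs' _ _ _ nUW.
- by move=> y /inH; apply: Hnil.
- by move=> h u /inH; apply: HU.
- by move=> h u /inH; apply: HW.
have vZ : v \in Z by apply/ZP.
(* [ad x] is nilpotent and stabilizes [Z], so the last iterate of [v] outside [W] is sent into [W]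
   by [x]. *)
have [w [wZ wW xw]] : exists w, [/\ w \in Z, w \notin W & [lie x, w] \in W].
  have : iter (dim L) (ad x) v \in W by rewrite Hnil ?mem0v.
  elim: (dim L) v vZ vW {vU Hv} => [|k IHk] v vZ vW;
    first by rewrite /= (negPf vW).
  rewrite iterSr adE; have [xvW _|xvW] := boolP ([lie x, v] \in W);
    first by exists v.
  by apply: IHk xvW; apply: xZ.
have [wU Hw] := (ZP w).1 wZ; exists w; split=> // h.
rewrite HE => /memv_addP[h' hH' [_ /vlineP[k ->] ->]].
by rewrite lieDl lieZl memvD ?memvZ // Hw.
Qed.

(** For a maximal subalgebra [M] of [S], Engel on [S / M] gives [v] with [[M, v]] in [M]; so
    [S = M + <v>], and its brackets fall into [M]. *)
Lemma engel_not_perfect S : subalgebra S -> S <> 0%VS ->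
  (forall x, x \in S -> forall v, iter (dim L) (ad x) v = 0) ->
  ~ (S <= derived S)%VS.
Proof.
move=> Ss S0 Snil Sperf.
have [|M [Ms /andP[_ MS] nMS Mmax]] :=
  ex_maximal_subalgebra_in (@subalgebra0 _ L) (sub0v S); first by move/esym.
have inS h : h \in M -> h \in S by apply: (subvP MS).
have nSM : ~~ (S <= M)%VS.
  by apply/negP => SM; apply: nMS; apply/eqP; rewrite eqEsubv MS.
have [|||v [vS vM Mv]] := @engel M S M Ms _ _ _ nSM.
- by move=> x /inS; apply: Snil.
- by move=> h u /inS hS; apply: Ss.
- exact: Ms.
have Mvlie := lie_addv_line Ms Mv.
have SE : S = (M + <[v]>)%VS.
  have [|||] // := Mmax (M + <[v]>)%VS.
  - by move=> y z yB zB; apply: (subvP (addvSl _ _)); apply: Mvlie.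
  - by rewrite addvSl subv_add MS -memvE.
  by move=> E; move: vM; rewrite -E memvE addvSr.
move/negP: nSM; apply; apply: subv_trans Sperf _.
by apply: derived_le => x y; rewrite SE; apply: Mvlie.
Qed.

End Engel.

(** * The trace form and orthogonal ideals *)

Section Killing.
Variables (K : fieldType) (L : lieAlgType K).
Implicit Types (x y z u v : L) (U W : {vspace L}).

Definition killing x y : K := lfun_tr (ad x \o ad y)%VF.

Lemma killingC x y : killing x y = killing y x.
Proof. exact: lfun_trC. Qed.

Lemma killingP k x y z : killing (k *: x + y) z = k * killing x z + killing y z.
Proof. by rewrite /killing adP comp_lfunDl -comp_lfunZl lfun_trP. Qed.

Lemma killing_lie x y z : killing [lie x, y] z = killing x [lie y, z].
Proof.
rewrite /killing !ad_lie comp_lfunDl comp_lfunDr comp_lfunNl comp_lfunNr.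
rewrite !lfun_trD !lfun_trN !comp_lfunA [lfun_tr ((ad y \o _) \o _)]lfun_trC.
by rewrite comp_lfunA [lfun_tr ((ad z \o _) \o _)]lfun_trC comp_lfunA.
Qed.

(** Pairing with a basis of [U] has a target of dimension [\dim U], so rank-nullity bounds the
    dimension of its kernel [perp U] from below. *)
Definition killing_row U x : 'rV[K]_(\dim U) := \row_i killing x (vbasis U)`_i.

Fact killing_row_linear U : linear (killing_row U).
Proof. by move=> k x y; apply/rowP => i; rewrite !mxE killingP. Qed.
HB.instance Definition _ U :=
  GRing.isLinear.Build K L _ *:%R (killing_row U) (killing_row_linear U).

Definition perp U : {vspace L} := lker (linfun (killing_row U)).

Lemma perpP U x : x \in perp U <-> forall y, y \in U -> killing x y = 0.
Proof.
rewrite memv_ker lfunE /=; split=> [/eqP/rowP ex y yU|xU].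
  have [W WP] : exists W : {vspace L}, forall z, z \in W <-> killing z x = 0.
    apply: vspace_of_pred => [|k u v ux vx];
      last by rewrite killingP ux vx mulr0 addr0.
    by have := killingP (-1) 0 0 x; rewrite scaler0 addr0 mulN1r addNr.
  rewrite killingC; apply/WP; rewrite (coord_vbasis yU) memv_suml // => i _.
  by rewrite memvZ //; apply/WP; rewrite killingC; have := ex i; rewrite !mxE.
by apply/eqP/rowP => i; rewrite !mxE xU // vbasis_mem // mem_nth ?size_tuple.
Qed.

Lemma dim_perp U : (\dim {:L} <= \dim U + \dim (perp U))%N.
Proof.
rewrite -(limg_ker_dim (linfun (killing_row U))) capfv addnC leq_add2r.
by rewrite (leq_trans (dimvS (subvf _))) // dimvf /dim /= mul1n.
Qed.

Lemma perp_ideal U : lie_ideal U -> lie_ideal (perp U).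
Proof.
move=> Ui x y /perpP yU; apply/perpP => z zU.
by rewrite killingC -killing_lie killingC yU // lie_idealr.
Qed.

Lemma add_perp U : (U :&: perp U = 0)%VS -> (U + perp U)%VS = fullv.
Proof.
move=> U0; apply/eqP; rewrite eqEdim subvf /=.
by rewrite dimv_disjoint_sum // dim_perp.
Qed.

End Killing.

Lemma geig_zero_nilpotent (K : fieldType) (L : lieAlgType K) s (x : L) :
  annihilates (ad x) s -> (forall l, l \in s -> l = 0) ->
  forall v, iter (dim L) (ad x) v = 0.
Proof.
move=> xs s0 v; elim: (annihilates_gsum v xs) => [|l w wl|u w _ uz _ wz].
- exact: iter_lfun0.
- have [->|w0] := eqVneq w 0; first exact: iter_lfun0.
  have l0 := s0 _ (annihilates_geig xs wl w0).
  rewrite -[RHS](geig_dim wl) l0; apply: eq_iter => u.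
  by rewrite shiftE scale0r subr0.
by rewrite iter_lfunD uz wz addr0.
Qed.

(* Let [D] act on the generalized eigenspace of [ad x] for [l] as the
   conjugate of [l].  It is a derivation since conjugation is additive, and
   invariance of the trace form gives [tr (ad x D) = 0]; but this trace is the
   sum of the [|l|^2]. *)
Lemma cartan_nilpotent (C : numClosedFieldType) (L : lieAlgType C)
    (S : {vspace L}) :
  lie_ideal S -> (S <= derived S)%VS ->
  (forall x y, x \in S -> y \in S -> killing x y = 0) ->
  forall x, x \in S -> forall v, iter (dim L) (ad x) v = 0.
Proof.
move=> Si Sperf S0 x xS; have [s [xs sD]] := semisimple_fun (ad x).
apply: (geig_zero_nilpotent xs).
have [D [Deig Dstab Dtr]] := sD (fun l => l^*).
have {}Deig l v : geig (ad x) l v -> D v = l^* *: v.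
  move=> vl; have [->|v0] := eqVneq v 0; first by rewrite linear0 scaler0.
  by apply: Deig (geig_dim vl); apply: annihilates_geig xs vl v0.
have Dder u v : D [lie u, v] = [lie D u, v] + [lie u, D v].
  elim: (annihilates_gsum u xs) => [|l a al|a b _ IHa _ IHb].
  - by rewrite !(lie0l, linear0) addr0.
  - elim: (annihilates_gsum v xs) => [|m c cm|c d _ IHc _ IHd].
    + by rewrite !(lie0r, linear0) addr0.
    + rewrite (Deig _ _ al) (Deig _ _ cm) (Deig _ _ (geig_lie al cm)).
      by rewrite lieZl lieZr -scalerDl rmorphD.
    by rewrite lieDr !linearD /= IHc IHd addrACA.
  by rewrite lieDl !linearD /= IHa IHb !lieDl addrACA.
have DS y : y \in S -> D y \in S.
  move=> yS; apply: (subvP (Dstab S _)); last exact: memv_img.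
  by apply/subvP => _ /memv_imgP[z zS ->]; rewrite adE Si.
have [W WP] : exists W : {vspace L}, forall y, y \in W <-> lfun_tr (ad y \o
  D)%VF = 0.
  apply: vspace_of_pred => [|k u v uD vD].
    suff -> : ad (0 : L) = 0 by rewrite comp_lfun0l lfun_tr0.
    by apply/lfunP => v; rewrite zero_lfunE adE lie0l.
  by rewrite adP comp_lfunDl -comp_lfunZl lfun_trP uD vD mulr0 addr0.
have SW : (S <= W)%VS.
  apply: subv_trans Sperf _; apply: derived_le => y z yS zS; apply/WP.
  (* Thus [[D, ad z] = ad (D z)]; by cyclicity the trace of [[ad y, ad z] D] is [- killing y (D z)],
     which is 0 on [S]. *)
  have adD : (D \o ad z)%VF = ad (D z) + (ad z \o D)%VF.
    by apply/lfunP => v; rewrite add_lfunE !comp_lfunE !adE Dder.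
  rewrite ad_lie comp_lfunDl comp_lfunNl lfun_trD lfun_trN -!comp_lfunA.
  rewrite [lfun_tr (ad z \o _)]lfun_trC -comp_lfunA adD comp_lfunDr lfun_trD
    opprD.
  by rewrite [lfun_tr (_ \o ad (D z))](S0 y (D z)) ?DS // oppr0 add0r subrr.
have /WP := subvP SW x xS; rewrite Dtr => /eqP.
rewrite psumr_eq0 => [/allP s0 l /s0|l _]; last exact: mul_conjC_ge0.
by rewrite mul_conjC_eq0 => /eqP.
Qed.

(** The predicate [P] is a parameter so that one induction serves both ideals and invariant
    subspaces. *)
Definition minimal_in (K : fieldType) (V : vectType K) (P : {vspace V} -> Prop)
  S :=
  [/\ S <> 0%VS, P S &
    forall I, P I -> (I <= S)%VS -> I = 0%VS \/ I = S].

(** Otherwise [S] lies in [perp S]. As [S] is perfect by minimality, Cartan's argument makes its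
    elements ad-nilpotent, against Engel. *)
Lemma minimal_ideal_perp (C : numClosedFieldType) (L : lieAlgType C)
    (S : {vspace L}) :
  minimal_in (@lie_ideal _ L) S -> derived S <> 0%VS -> (S :&: perp S = 0)%VS.
Proof.
move=> [S0 Si Smin] Sd.
have [||//|SpS] := Smin (S :&: perp S)%VS.
- exact: ideal_cap (perp_ideal Si).
- exact: capvSl.
have Sperf : (S <= derived S)%VS.
  have [||/Sd//|->] := Smin (derived S); last exact: subvv.
  - exact: derived_ideal.
  - exact: idealS_derived.
case: (engel_not_perfect (ideal_subalgebra Si) S0 _ Sperf).
apply: (cartan_nilpotent Si Sperf) => x y xS yS.
by move: xS; rewrite -SpS => /memv_capP[_ /perpP]; apply.
Qed.

(** * Decomposition of Frattini-free algebras *)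

Definition linear_fun (K : fieldType) (U V : vectType K) (f : U -> V)
  (f_linear : linear f) : U -> V := f.

HB.instance Definition _ (K : fieldType) (U V : vectType K) (f : U -> V)
    (f_linear : linear f) :=
  GRing.isLinear.Build K U V *:%R (linear_fun f_linear) f_linear.

Lemma ex_lfun (K : fieldType) (U V : vectType K) (f : U -> V) :
  linear f -> exists F : 'Hom(U, V), forall x, F x = f x.
Proof. by move=> fl; exists (linfun (linear_fun fl)) => x; rewrite lfunE. Qed.

Definition abelian_subspace (K : fieldType) (L : lieAlgType K)
  (A : {vspace L}) := forall x y, x \in A -> y \in A -> [lie x, y] = 0.

(** For [B] of minimal dimension, [A :&: B] is an ideal since [A] is abelian. A maximal [M] not
    containing it would give [A + M :&: B = L], hence [M :&: B = B] by minimality, a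
    contradiction. *)
Lemma abelian_ideal_complement (K : fieldType) (L : lieAlgType K)
    (A : {vspace L}) :
  frattini_free L -> lie_ideal A -> abelian_subspace A ->
  exists B, [/\ subalgebra B, (A + B)%VS = fullv & (A :&: B = 0)%VS].
Proof.
move=> Lfree Ai Aab.
have [|B [Bs AB] Bmin] := @ex_min_dim _ L (fun B => subalgebra B /\ (A + B)%VS
  = fullv).
  by exists fullv; split; [exact: subalgebraf | rewrite addvf].
exists B; split=> //; apply/eqP; rewrite -subv0; apply/subvP => x xJ.
rewrite memv0; apply/eqP/Lfree => M [Ms Mf Mmax]; apply: contrapT => /negP xM.
set J := (A :&: B)%VS in xJ.
have Ji : lie_ideal J.
  move=> z y /memv_capP[yA yB].
  have : z \in (A + B)%VS by rewrite AB memvf.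
  case/memv_addP=> a aA [b bB ->]; rewrite lieDl (Aab a y) // add0r.
  by rewrite memv_cap Ai ?Bs.
have MJ : (M + J)%VS = fullv.
  have [||MJM|//] := Mmax (M + J)%VS; [exact: subalgebra_add | exact: addvSl |].
  by move: xM; rewrite -MJM (subvP (addvSr M J)).
have MBs : subalgebra (M :&: B)%VS by apply: subalgebra_cap.
have BE : B = (J + M :&: B)%VS.
  by rewrite vspace_modl ?capvSr // addvC MJ capfv.
have AMB : (A + M :&: B)%VS = fullv.
  apply/eqP; rewrite eqEsubv subvf -AB /=.
  rewrite subv_add addvSl {1}BE subv_add addvSr andbT.
  exact: subv_trans (capvSl _ _) (addvSl _ _).
have MBB : (M :&: B)%VS = B by apply/eqP; rewrite eqEdim capvSr Bmin.
have xB : x \in B by move: xJ => /memv_capP[].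
by move: xM; rewrite -MBB in xB; case/memv_capP: xB => ->.
Qed.

(** A minimal [S] inside [U] has a complement; by the modular law its intersection with [U] is a
    complement within [U], of smaller dimension. *)
Lemma minimal_in_ind (K : fieldType) (V : vectType K)
    (P Q : {vspace V} -> Prop) (T : {vspace V}) :
  (forall U W, P U -> P W -> P (U :&: W)%VS) ->
  (forall S, minimal_in P S -> (S <= T)%VS ->
    exists S', [/\ P S', (S :&: S' = 0)%VS & (T <= S + S')%VS]) ->
  Q 0%VS ->
  (forall S W, minimal_in P S -> P W -> (S :&: W = 0)%VS -> (S + W <= T)%VS ->
    Q W -> Q (S + W)%VS) ->
  P T -> Q T.
Proof.
move=> Pcap compl Q0 QD PT.
suff QT n U : (\dim U <= n)%N -> (U <= T)%VS -> P U -> Q U.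
  exact: QT (leqnn _) (subvv T) PT.
elim: n U => [|n IHn] U dU UT PU.
  by move: dU; rewrite leqn0 dimv_eq0 => /eqP->.
have [->//|/eqP U0] := eqVneq U 0%VS.
have [|S [S0 PS SU] Smin] := @ex_min_dim _ _ (fun S => [/\ S <> 0%VS, P S & (S
  <= U)%VS]).
  by exists U; rewrite subvv.
have Sm : minimal_in P S.
  split=> // I PI IS; have [->|/eqP I0] := eqVneq I 0%VS; [by left|right].
  by apply/eqP; rewrite eqEdim IS Smin //; split=> //; apply: subv_trans SU.
have [S' [PS' SS' TSS']] := compl S Sm (subv_trans SU UT).
have UE : U = (S + (S' :&: U))%VS.
  by rewrite vspace_modl //; apply/esym/capv_idPr; apply: subv_trans TSS'.
have capS : (S :&: (S' :&: U) = 0)%VS by rewrite capvA SS' cap0v.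
rewrite UE; apply: QD => //; [exact: Pcap | by rewrite -UE |].
apply: IHn; [|exact: subv_trans (capvSr _ _) UT | exact: Pcap].
rewrite -ltnS (leq_trans _ dU) // [in X in (_ < X)%N]UE dimv_disjoint_sum //.
by rewrite -[X in (X < _)%N]add0n ltn_add2r lt0n dimv_eq0; apply/eqP.
Qed.

(** Stated for subspaces, so that summands can be added one at a time until the whole algebra is
    reached. *)
Definition lie_decomp (K : fieldType) (L : lieAlgType K) (U : {vspace L}) :=
  exists (n : nat) (F : 'I_n -> lieAlgType K) (f : 'Hom(dsum F, L)),
    [/\ forall i, frattini_free_summand (F i),
        forall x y, f [lie x, y] = [lie f x, f y],
        lker f == 0%VS & limg f = U].

Lemma lie_decomp0 (K : fieldType) (L : lieAlgType K) :
  lie_decomp (0 : {vspace L})%VS.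
Proof.
exists 0%N, (fun=> L), 0; split=> [[]//|x y||].
- by rewrite !zero_lfunE lie0l.
- by apply/lker0P => x y _; apply: dsumP => -[].
exact: lim0g.
Qed.

Section DsumCons.
Variables (K : fieldType) (n : nat) (M : lieAlgType K) (F : 'I_n -> lieAlgType
  K).

(* Defined by matching on the underlying natural number, so that the value at a
   successor is convertible to the corresponding [F i]. *)
Definition cons_fam (i : 'I_n.+1) : lieAlgType K :=
  let: Ordinal k kn := i in
  match k return (k < n.+1)%N -> lieAlgType K with
  | 0 => fun=> M
  | k'.+1 => fun kn' => F (Ordinal (kn' : (k' < n)%N))
  end kn.

Definition cons_elt (m : M) (u : dsum F) (i : 'I_n.+1) : cons_fam i :=
  let: Ordinal k kn := i return cons_fam i in
  match k return forall kn : (k < n.+1)%N, cons_fam (Ordinal kn) with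
  | 0 => fun=> m
  | k'.+1 => fun kn' => u (Ordinal (kn' : (k' < n)%N))
  end kn.

Definition head_elt (x : dsum cons_fam) : M := x (Ordinal (ltn0Sn n)).

Definition tail_elt (x : dsum cons_fam) : dsum F :=
  dsum_mk (fun i => let: Ordinal k kn := i return F i in
    (x (@Ordinal n.+1 k.+1 kn) : F (Ordinal kn))).

Lemma cons_elt_inj x y :
  head_elt x = head_elt y -> tail_elt x = tail_elt y -> x = y.
Proof.
move=> hxy txy; apply: dsumP => -[[|k] kn].
  by rewrite (bool_irrelevance kn (ltn0Sn n)).
have := congr1 (fun u : dsum F => u (Ordinal (kn : (k < n)%N))) txy.
by rewrite !dsum_mkE.
Qed.

Lemma head_consE m u : head_elt (dsum_mk (cons_elt m u)) = m.
Proof. by rewrite /head_elt dsum_mkE. Qed.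

Lemma tail_consE m u : tail_elt (dsum_mk (cons_elt m u)) = u.
Proof. by apply: dsumP => -[k kn]; rewrite dsum_mkE dsum_mkE. Qed.

Fact head_elt_linear : linear head_elt.
Proof. by move=> k x y; rewrite /head_elt dsum_addE dsum_scaleE. Qed.

Fact tail_elt_linear : linear tail_elt.
Proof.
move=> k x y; apply: dsumP => -[i ilt].
by rewrite dsum_addE dsum_scaleE !dsum_mkE.
Qed.

Lemma head_lie x y : head_elt [lie x, y] = [lie head_elt x, head_elt y].
Proof. by rewrite /head_elt dsum_bracketE. Qed.

Lemma tail_lie x y : tail_elt [lie x, y] = [lie tail_elt x, tail_elt y].
Proof.
apply: dsumP => -[i ilt]; by rewrite [RHS]dsum_bracketE !dsum_mkE.
Qed.

End DsumCons.

(** The images of [g] and [f] commute, so their sum is a homomorphism; they meet in 0, so it is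
    injective. *)
Lemma lie_decomp_cons (K : fieldType) (L M : lieAlgType K) (g : 'Hom(M, L))
    (U : {vspace L}) :
  frattini_free_summand M -> (forall x y, g [lie x, y] = [lie g x, g y]) ->
  lker g == 0%VS -> (limg g :&: U = 0)%VS ->
  (forall x u, u \in U -> [lie g x, u] = 0) ->
  lie_decomp U -> lie_decomp (limg g + U)%VS.
Proof.
move=> Msum gM gker gU0 gU [n [F [f [Fsum fM fker fU]]]].
pose e (x : dsum (cons_fam M F)) := g (head_elt x) + f (tail_elt x).
have e_lin : linear e.
  move=> k x y; rewrite /e head_elt_linear tail_elt_linear !linearP /=.
  by rewrite scalerDr addrACA.
have [E EE] := ex_lfun e_lin.
have gf x u : [lie g x, f u] = 0 by rewrite gU // -fU memv_img ?memvf.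
exists n.+1, (cons_fam M F), E; split.
- by case=> [[|k] kn]; [exact: Msum | exact: Fsum].
- move=> x y; rewrite !EE /e head_lie tail_lie gM fM lieDl !lieDr gf.
  by rewrite (lieC (f _) (g _)) gf oppr0 addr0 add0r.
- rewrite -subv0; apply/subvP => x; rewrite memv_ker EE memv0 /e addr_eq0.
  move=> /eqP xE; have : g (head_elt x) \in (limg g :&: U)%VS.
    by rewrite memv_cap memv_img ?memvf //= xE memvN -fU memv_img ?memvf.
  rewrite gU0 memv0 => /eqP gx0; have /eqP := gx0;
    rewrite xE oppr_eq0 => /eqP fx0.
  apply/eqP/cons_elt_inj.
    apply: (lker0P gker); rewrite gx0 -(linear0 g); congr (g _).
    by rewrite /head_elt dsum_zeroE.
  apply: (lker0P fker); rewrite fx0 -(linear0 f); congr (f _).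
  by apply: dsumP => -[k kn]; rewrite !dsum_mkE.
apply/vspaceP => v; apply/memv_imgP/memv_addP.
  case=> x _ ->; exists (g (head_elt x)); first by rewrite memv_img ?memvf.
  by exists (f (tail_elt x)); rewrite ?EE // -fU memv_img ?memvf.
case=> _ /memv_imgP[m _ ->] [u + ->]; rewrite -fU => /memv_imgP[w _ ->].
exists (dsum_mk (cons_elt m w)); first exact: memvf.
by rewrite EE /e head_consE tail_consE.
Qed.

Lemma lie_decomp_isomorphic (K : fieldType) (L : lieAlgType K) :
  lie_decomp {:L}%VS ->
  exists (n : nat) (F : 'I_n -> lieAlgType K),
    (forall i, frattini_free_summand (F i)) /\ lie_isomorphic L (dsum F).
Proof.
move=> [n [F [f [Fsum fM fker fU]]]]; exists n, F; split=> //.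
have fK := lker0_lfunK fker; have fVK y : f (f^-1%VF y) = y.
  by rewrite limg_lfunVK // fU memvf.
exists (f^-1)%VF; split=> [|x y]; first by exists f.
by apply: (lker0P fker); rewrite fM !fVK.
Qed.

Lemma sum_direct_cons (K : fieldType) (V : vectType K) n (U : 'I_n -> {vspace
  V})
    (S : {vspace V}) (U' := fun i : 'I_n.+1 => oapp U S (unlift ord0 i)) :
  directv (\sum_i U i)%VS -> (S :&: \sum_i U i = 0)%VS ->
  (\sum_i U' i = S + \sum_i U i)%VS /\ directv (\sum_i U' i)%VS.
Proof.
move=> Udir SU0.
have sumE : (\sum_i U' i = S + \sum_i U i)%VS.
  rewrite big_ord_recl /U' unlift_none /=; congr (_ + _)%VS.
  by apply: eq_bigr => i _; rewrite liftK.
split=> //; rewrite directvE /= sumE big_ord_recl /U' unlift_none /=.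
rewrite dimv_disjoint_sum // eqn_add2l; move: Udir; rewrite directvE /=.
by move=> /eqP->; apply/eqP/eq_bigr => i _; rewrite liftK.
Qed.

Lemma decomposable_of_complement (K : fieldType) (X : vectType K)
    (A : lieSubalg (gl X)) :
  (forall S, op_invariant A S ->
    exists S', [/\ op_invariant A S', (S :&: S' = 0)%VS & (S + S')%VS = fullv])
      ->
  decomposable A.
Proof.
move=> compl; pose Q W := exists (n : nat) (U : 'I_n -> {vspace X}),
  [/\ (\sum_i U i)%VS = W, directv (\sum_i U i)%VS &
      forall i, minimal_invariant A (U i)].
suff : Q fullv by [].
apply: (minimal_in_ind (P := op_invariant A)) => [U W Ui Wi a aA|S [_ Si _]
  _|||a aA].
- apply/subvP => _ /memv_imgP[x /memv_capP[xU xW] ->].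
  rewrite memv_cap (subvP (Ui a aA)) ?memv_img //=.
  by apply: (subvP (Wi a aA)); rewrite memv_img.
- by have [S' [S'i SS' SSf]] := compl S Si; exists S'; rewrite SSf subvv.
- exists 0%N, (fun=> 0%VS); split=> [||[]//]; first by rewrite big_ord0.
  by rewrite directvE /= !big_ord0 dimv0.
- move=> S W Smin _ SW0 _ [n [U [Usum Udir Umin]]].
  have [|sumE dirE] := @sum_direct_cons _ _ _ U S Udir; first by rewrite Usum.
  exists n.+1, (fun i => oapp U S (unlift ord0 i)); split=> //.
    by rewrite sumE Usum.
  by move=> i; case: (unlift ord0 i) => [j|] /=; [exact: Umin | exact: Smin].
exact: subvf.
Qed.

(** * The semidirect summand *)

Section Restriction.
Variables (K : fieldType) (L : lieAlgType K) (N : {vspace L}).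
Local Notation X := (subvs_of N).

(** The projection makes this total; when [N] is an ideal it changes nothing, and this is the
    restriction of [ad b]. *)
Definition restr_ad (b : L) : gl X :=
  (linfun (@vsproj _ _ N) \o (ad b \o linfun (@vsval _ _ N)))%VF.

Lemma restr_adE b x : lie_ideal N -> vsval (restr_ad b x) = [lie b, vsval x].
Proof.
by move=> Ni; rewrite !comp_lfunE !lfunE /= vsprojK // Ni // subvsP.
Qed.

Lemma restr_ad_linear : linear restr_ad.
Proof.
move=> k b c; apply/lfunP => x;
  rewrite [RHS]gl_addE gl_scaleE !comp_lfunE !lfunE /=.
by rewrite lieDl lieZl linearP.
Qed.

End Restriction.

(** [E] embeds in the operators on [N] with image [A]. As [N] is abelian, [(a; x) |-> tau a + x]
    identifies the semidirect product of [A] and [N] with [N + E]. *)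
Lemma lie_decomp_semidirect (K : fieldType) (L : lieAlgType K)
    (N E : {vspace L}) :
  lie_ideal N -> abelian_subspace N -> subalgebra E -> (N :&: E = 0)%VS ->
  (forall b, b \in E -> (forall x, x \in N -> [lie b, x] = 0) -> b = 0) ->
  (forall S, (S <= N)%VS ->
     (forall b x, b \in E -> x \in S -> [lie b, x] \in S) ->
     exists S' : {vspace L}, [/\ forall b x, b \in E -> x \in S' -> [lie b, x]
       \in S',
       (S :&: S' = 0)%VS & (N <= S + S')%VS /\ (S' <= N)%VS]) ->
  lie_decomp (N + E)%VS.
Proof.
move=> Ni Nab Es NE0 Efaith Ecompl.
pose X := subvs_of N.
have [rho rhoE] := ex_lfun (@restr_ad_linear K L N).
have rhoV b (x : X) : vsval (rho b x) = [lie b, vsval x].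
  by rewrite rhoE restr_adE.
have vsval_inj (x y : X) : vsval x = vsval y -> x = y by apply: val_inj.
have rho_lie b c : rho [lie b, c] = [lie rho b, rho c].
  apply/lfunP => x; apply: vsval_inj.
  by rewrite rhoV gl_lieE linearB /= !rhoV (lieA b) addrK.
have As : @subalgebra K (gl X) (rho @: E)%VS.
  move=> _ _ /memv_imgP[b bE ->] /memv_imgP[c cE ->].
  by rewrite -rho_lie memv_img // Es.
pose A : lieSubalg (gl X) := LieSubalg As.
have rho_inj b : b \in E -> rho b = 0 -> b = 0.
  move=> bE b0; apply: Efaith => // x xN.
  by rewrite -(vsprojK xN) -rhoV b0 zero_lfunE linear0.
pose r : 'Hom(subvs_of E, gl X) := (rho \o linfun (@vsval _ _ E))%VF.
have rE b : r b = rho (vsval b) by rewrite comp_lfunE lfunE.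
have rker : lker r == 0%VS.
  rewrite -subv0; apply/subvP => b; rewrite memv_ker rE memv0 => /eqP b0.
  by apply/eqP/val_inj; rewrite /= (rho_inj _ _ b0) ?subvsP.
(* The inverse of the faithful action: the element of [E] inducing the operator [a]. *)
pose tau (a : lsub_type A) : L := vsval ((r^-1)%VF (lsub_val a)).
have tauE a : tau a \in E by apply: subvsP.
have rho_tau a : rho (tau a) = lsub_val a.
  rewrite -rE limg_lfunVK //; have /memv_imgP[b bE ->] := lsub_valP a.
  by rewrite -(vsprojK bE) -rE memv_img ?memvf.
have rho_injE b c : b \in E -> c \in E -> rho b = rho c -> b = c.
  move=> bE cE bc; apply/eqP; rewrite -subr_eq0; apply/eqP/rho_inj.
    exact: memvB.
  by rewrite linearB /= bc subrr.
have tau_lin : linear tau by move=> k a b; rewrite /tau !linearP.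
have tau_lie a b : tau [lie a, b] = [lie tau a, tau b].
  by apply: rho_injE; rewrite ?Es // rho_lie !rho_tau lsub_lieE.
have tau_onto b : b \in E -> exists a, tau a = b.
  move=> bE; have aA : rho b \in (A : {vspace gl X}) by exact: memv_img.
  exists (Subvs aA : lsub_type A); apply: rho_injE => //.
have tau0 a : tau a = 0 -> a = 0.
  by move=> a0; apply: lsub_val_inj; rewrite -rho_tau a0 !linear0.
pose e (u : semidirect A) : L := tau u.1 + vsval u.2.
have e_lin : linear e.
  move=> k u v; rewrite /e /= tau_lin.
  by rewrite scalerDr addrACA.
have [g gE] := ex_lfun e_lin.
have Adec : decomposable A.
  apply: decomposable_of_complement => S Si.
  pose v : 'Hom(X, L) := linfun (@vsval _ _ N).
  have vE x : v x = vsval x by rewrite lfunE.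
  have [||S' [S'i SS' [NS S'N]]] := Ecompl (v @: S)%VS.
  - by apply/subvP => _ /memv_imgP[x _ ->]; rewrite vE subvsP.
  - move=> b _ bE /memv_imgP[x xS ->]; rewrite vE -rhoV -vE memv_img //.
    by apply: (subvP (Si _ (memv_img rho bE))); apply: memv_img.
  exists (v @^-1: S')%VS; split.
  - move=> _ /memv_imgP[b bE ->]; apply/subvP => _ /memv_imgP[x xS ->].
    by rewrite -memv_preim vE rhoV -vE S'i // memv_preim.
  - apply/eqP; rewrite -subv0; apply/subvP => x /memv_capP[xS].
    rewrite -memv_preim => xS'; have : v x \in (v @: S :&: S')%VS.
      by rewrite memv_cap memv_img.
    by rewrite SS' !memv0 vE => /eqP x0; apply/eqP/vsval_inj.
  apply/vspaceP => x; rewrite memvf.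
  have /memv_addP[_ /memv_imgP[y yS ->] [w wS' xE]] := subvP NS _ (subvsP x).
  apply/memv_addP; exists y => //; exists (x - y); last by rewrite addrC subrK.
  by rewrite -memv_preim linearB /= (vE x) xE addrC addKr.
suff -> : (N + E = limg g + 0)%VS.
  apply: lie_decomp_cons; first exact: SemidirectId.
  - move=> u w; rewrite !gE /e /= tau_lie.
    rewrite -!rho_tau !rhoV lieDl !lieDr (Nab (vsval u.2) (vsval w.2)) ?subvsP
      //.
    by rewrite addr0 (lieC (vsval u.2)) addrA.
  - rewrite -subv0; apply/subvP => u;
    rewrite memv_ker gE memv0 /e addrC addr_eq0.
    move=> /eqP uE; have : vsval u.2 \in (N :&: E)%VS.
      by rewrite memv_cap subvsP uE memvN tauE.
    rewrite NE0 memv0 => /eqP u20; move/eqP: uE; rewrite u20 eq_sym oppr_eq0.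
    move=> /eqP/tau0 u10; apply/eqP; case: u u10 u20 => a x /= -> x0.
    by congr pair; apply: vsval_inj.
  - exact: capv0.
  - by move=> x u; rewrite memv0 => /eqP->; rewrite lie0r.
  exact: lie_decomp0.
rewrite addv0; apply/vspaceP => y; apply/memv_addP/memv_imgP.
  case=> x xN [b bE ->]; have [a aE] := tau_onto b bE.
  exists (a, vsproj N x); first exact: memvf.
  by rewrite gE /e /= aE vsprojK // addrC.
case=> u _ ->; exists (vsval u.2); first exact: subvsP.
by exists (tau u.1); rewrite // gE /e addrC.
Qed.

Lemma lie_ideals_commute (K : fieldType) (L : lieAlgType K) (I J : {vspace L}) :
  lie_ideal I -> lie_ideal J -> (I :&: J = 0)%VS ->
  forall x y, x \in I -> y \in J -> [lie x, y] = 0.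
Proof.
move=> Ii Ji IJ0 x y xI yJ; apply/eqP.
by rewrite -memv0 -IJ0 memv_cap Ji // lie_idealr.
Qed.

(** [S'] commutes with [S], so an ideal of [S] is an ideal of the whole algebra and minimality
    applies. *)
Lemma simple_of_minimal_ideal (K : fieldType) (L : lieAlgType K)
    (S : lieSubalg L) (S' : {vspace L}) :
  minimal_in (@lie_ideal _ L) S -> derived S <> 0%VS ->
  lie_ideal S' -> (S :&: S' = 0)%VS -> (S + S')%VS = fullv ->
  lie_simple (lsub_type S).
Proof.
move=> [S0 Si Smin] Sd S'i SS'0 SS'f; split.
  apply: contrapT => nab; apply: Sd; apply/eqP; rewrite -subv0.
  apply: derived_le => x y xS yS; rewrite memv0; apply/eqP.
  apply: contrapT => xy0; apply: nab.
  exists (Subvs xS : lsub_type S), (Subvs yS : lsub_type S) => xy.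
  by apply: xy0; have := congr1 (@lsub_val _ _ S) xy; rewrite lsub_lieE linear0.
move=> U Ui; pose v : 'Hom(lsub_type S, L) := linfun (@lsub_val _ _ S).
have vE x : v x = lsub_val x by rewrite lfunE.
have vker : lker v == 0%VS.
  by apply/lker0P => x y; rewrite !vE; apply: lsub_val_inj.
have [||vU0|vUS] := Smin (v @: U)%VS.
- move=> z _ /memv_imgP[u uU ->].
  have : z \in (S + S')%VS by rewrite SS'f memvf.
  case/memv_addP=> s sS [s' sS' ->]; rewrite lieDl [[lie s', _]]lieC.
  rewrite (lie_ideals_commute Si S'i SS'0 _ sS') ?vE ?subvsP // oppr0 addr0.
  by rewrite -[s]/(lsub_val (Subvs sS)) -lsub_lieE -vE memv_img // Ui.
- by apply/subvP => _ /memv_imgP[u _ ->]; rewrite vE subvsP.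
- by left; apply/eqP; rewrite -(eq_limg_ker0 _ _ vker) vU0 limg0.
right; apply/vspaceP => x; rewrite memvf.
have : v x \in (v @: U)%VS by rewrite vUS vE subvsP.
by case/memv_imgP=> y yU /(lker0P vker) ->.
Qed.

Lemma frattini_free_decomp (C : numClosedFieldType) (L : lieAlgType C) :
  frattini_free L -> lie_decomp {:L}%VS.
Proof.
move=> Lfree.
have [|N [Ni Nab] Nmax] :=
  @ex_max_dim _ L (fun N => lie_ideal N /\ abelian_subspace N).
  exists 0%VS; split; first exact: ideal0.
  by move=> x y; rewrite memv0 => /eqP->; rewrite lie0l.
have [B [Bs NB NB0]] := abelian_ideal_complement Lfree Ni Nab.
have [Z ZP] : exists Z : {vspace L},
    forall x, x \in Z <-> forall y, y \in N -> [lie x, y] = 0.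
  apply: vspace_of_pred => [y _|k u v uN vN y yN]; first by rewrite lie0l.
  by rewrite lieDl lieZl uN ?vN // scaler0 addr0.
pose I := (B :&: Z)%VS.
(* In [L = N + B] the part [N] commutes with [I], while [B] normalizes both itself and the
   centralizer [Z] of [N]. *)
have Ii : lie_ideal I.
  move=> x c /memv_capP[cB /ZP cN].
  have : x \in (N + B)%VS by rewrite NB memvf.
  case/memv_addP=> n nN [b bB ->]; rewrite lieDl lieC cN // oppr0 add0r.
  rewrite memv_cap Bs //=; apply/ZP => y yN.
  have := lieA b c y; rewrite (cN y) // lie0r (cN [lie b, y]) ?Ni //.
  by rewrite addr0.
have IN0 J : lie_ideal J -> (J <= I)%VS -> abelian_subspace J -> J = 0%VS.
  move=> Ji JI Jab; have JC x y : x \in J -> y \in N -> [lie x, y] = 0.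
    by move=> /(subvP JI)/memv_capP[_ /ZP]; apply.
  (* [N + J] is an abelian ideal, so maximality of [N] puts [J] inside [N], which meets [B]
     trivially. *)
  have NJab : abelian_subspace (N + J)%VS.
    move=> _ _ /memv_addP[n nN [j jJ ->]] /memv_addP[n' nN' [j' jJ' ->]].
    rewrite lieDl !lieDr (Nab n n') // (Jab j j') // (JC j n') // (lieC n j')
      (JC j' n) //.
    by rewrite oppr0 !addr0.
  have NNJ : N = (N + J)%VS.
    apply/eqP; rewrite eqEdim addvSl Nmax //; split=> //; exact: ideal_add.
  apply/eqP; rewrite -subv0 -NB0 subv_cap {1}NNJ addvSr.
  exact: subv_trans JI (capvSl _ _).
have Imin S : minimal_in (@lie_ideal _ L) S -> (S <= I)%VS -> derived S <> 0%VS.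
  move=> [S0 Si _] SI Sd; apply: S0; apply: IN0 => // x y xS yS.
  by apply/eqP; rewrite -memv0 -Sd mem_derived.
have Iperp S : minimal_in (@lie_ideal _ L) S -> (S <= I)%VS ->
    (S :&: perp S = 0)%VS.
  by move=> Sm SI; apply: minimal_ideal_perp => //; apply: Imin.
have Icompl S : minimal_in (@lie_ideal _ L) S -> (S <= I)%VS ->
    exists S', [/\ lie_ideal S', (S :&: S' = 0)%VS & (I <= S + S')%VS].
  move=> Sm SI; have SpS := Iperp S Sm SI.
  by exists (perp S); rewrite add_perp // subvf; split=> //; apply: perp_ideal;
    case: Sm.
pose D := perp I.
have Di : lie_ideal D by apply: perp_ideal.
have ID0 : (I :&: D = 0)%VS.
  apply: (minimal_in_ind (P := @lie_ideal _ L)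
            (Q := fun J => (J <= D)%VS -> J = 0%VS) (T := (I :&: D)%VS)).
  - by move=> U W Ui Wi; apply: ideal_cap.
  - move=> S Sm /subv_trans SI.
    have [S' [S'i SS' IS]] := Icompl S Sm (SI _ (capvSl _ _)).
    by exists S'; split=> //; apply: subv_trans (capvSl _ _) IS.
  - by [].
  (* A minimal ideal [S] inside both [I] and [perp I] would lie in [perp S], against [Iperp]. *)
  - move=> S W Sm _ _ SWID _ SWD; have [S0 _ _] := Sm; case: S0.
    have /andP[SI SD] : (S <= I)%VS && (S <= D)%VS.
      by rewrite -subv_cap (subv_trans _ SWID) ?addvSl.
    rewrite -(Iperp S Sm SI);
      apply/esym/capv_idPl/subvP => x /(subvP SD)/perpP xI.
    by apply/perpP => y /(subvP SI); apply: xI.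
  - exact: ideal_cap.
  exact: capvSr.
have IDf : (I + D)%VS = fullv by apply: add_perp.
have ND : (N <= D)%VS.
  apply/subvP => n nN; apply/perpP => c cI.
  (* [ad c] maps [L] into the ideal [I], which [n] centralizes, so the product itself vanishes. *)
  suff nc0 : (ad n \o ad c)%VF = 0 by rewrite /killing nc0 lfun_tr0.
  apply/lfunP => x; rewrite comp_lfunE zero_lfunE !adE lieC.
  have /memv_capP[_ /ZP->] : [lie c, x] \in I by apply: lie_idealr.
    exact: oppr0.
  exact: nN.
have DE : D = (N + B :&: D)%VS by rewrite vspace_modl // NB capfv.
have Ddecomp : lie_decomp D.
  rewrite DE; apply: lie_decomp_semidirect => //.
  - by apply: subalgebra_cap => //; apply: ideal_subalgebra.
  - by rewrite capvA NB0 cap0v.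
  (* Faithfulness: an element of [B :&: D] centralizing [N] lies in [I :&: D]. *)
  - move=> b /memv_capP[bB bD] bN; apply/eqP.
    by rewrite -memv0 -ID0 !memv_cap bB bD andbT; apply/ZP.
  move=> S SN SE.
  (* [L] is the sum of [I], [N] and [B :&: D]; the first two centralize [S] and the third stabilizes
     it. *)
  have Si : lie_ideal S.
    move=> x s sS; have : x \in (I + D)%VS by rewrite IDf memvf.
    have sN := subvP SN s sS.
    rewrite DE => /memv_addP[c /memv_capP[_ /ZP cN] [_ /memv_addP[n nN [b bE
      ->]] ->]].
    by rewrite !lieDl cN // (Nab n) // !add0r SE.
  have Sab : abelian_subspace S.
    by move=> x y /(subvP SN) xN /(subvP SN); apply: Nab.
  have [B1 [B1s SB1 SB10]] := abelian_ideal_complement Lfree Si Sab.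
  (* [S] acts trivially on [N], so by [L = S + B1] stability under [B1] is enough. *)
  exists (B1 :&: N)%VS; split.
  - move=> b x _ /memv_capP[xB1 xN];
    have : b \in (S + B1)%VS by rewrite SB1 memvf.
    case/memv_addP=> s sS [b1 bB1 ->].
    rewrite lieDl (Nab s x) ?(subvP SN s) // add0r memv_cap B1s //=.
    exact: Ni.
  - by rewrite capvA SB10 cap0v.
  by rewrite capvSr vspace_modl // SB1 capfv.
(* Starting from [D], the minimal ideals inside [I] are added one at a time, each a simple
   summand. *)
rewrite -IDf; apply: (minimal_in_ind (P := @lie_ideal _ L)
  (Q := fun W => lie_decomp (W + D)%VS) (T := I)) => //.
- by move=> U W Ui Wi; apply: ideal_cap.
- by rewrite add0v.
move=> S W Sm Wi SW0 SWI WD; have [S0 Si _] := Sm.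
have SI : (S <= I)%VS := subv_trans (addvSl _ _) SWI.
have WI : (W <= I)%VS := subv_trans (addvSr _ _) SWI.
pose A := LieSubalg (ideal_subalgebra Si).
pose v : 'Hom(lsub_type A, L) := linfun (@lsub_val _ _ A).
have vE x : v x = lsub_val x by rewrite lfunE.
have vS : limg v = S.
  apply/vspaceP => x; apply/memv_imgP/idP => [[y _ ->]|xS].
    by rewrite vE subvsP.
  by exists (Subvs xS : lsub_type A); rewrite ?memvf // vE.
have SWD0 : (S :&: (W + D) = 0)%VS.
  apply/eqP; rewrite -subv0; apply/subvP => x /memv_capP[xS].
  case/memv_addP=> w wW [d dD xE]; rewrite memv0.
  have d0 : d = 0.
    apply/eqP; rewrite -memv0 -ID0 memv_cap dD andbT.
    have -> : d = x - w by rewrite xE addrC addKr.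
    by apply: memvB; [apply: (subvP SI) | apply: (subvP WI)].
  by rewrite -memv0 -SW0 memv_cap xS xE d0 addr0.
rewrite -addvA -{1}vS; apply: lie_decomp_cons => //.
- apply: SimpleLie; apply: (@simple_of_minimal_ideal _ _ A (perp S)) => //=.
  + exact: Imin.
  + exact: perp_ideal.
  + exact: Iperp.
  by rewrite add_perp // Iperp.
- by move=> x y; rewrite !vE lsub_lieE.
- by apply/lker0P => x y; rewrite !vE; apply: lsub_val_inj.
- by rewrite vS.
move=> x u uWD; apply: (lie_ideals_commute Si _ SWD0) => //.
  exact: ideal_add.
by rewrite vE subvsP.
Qed.

Lemma frattini_free_summandP (C : numClosedFieldType) (L : lieAlgType C) :
  frattini_free_summand L -> frattini_free L.
Proof.
by case=> [M /frattini_free_dim1|M /frattini_free_simple|X A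
  /frattini_free_semidirect].
Qed.

Theorem corollary9p13 (R : realType) (L : lieAlgType R[i]) :
  frattini_free L <->
  exists (n : nat) (F : 'I_n -> lieAlgType R[i]),
    (forall i, frattini_free_summand (F i)) /\ lie_isomorphic L (dsum F).
Proof.
split=> [/frattini_free_decomp/lie_decomp_isomorphic //|[n [F [Fsum LF]]]].
apply: (frattini_free_dsum LF) => i.
exact: frattini_free_summandP.
Qed.
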